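(* Let $C=\{(x,y(x)) : x\in B\}\subset M$ be a smooth section of the semi-flat torus fibration $\pi:M\to B$, where $y=(y^1,\dots,y^m):B\to\mathbb R^m$ is a smooth lift of the fibre coordinate, and let $D=d+i\sum_{j} y^j\,d\widetilde y_j$ be the associated $U(1)$ connection (the real Fourier-Mukai transform of $C$) on the trivial Hermitian line bundle over the dual torus fibration $W$, with curvature $F$. Let $\theta\in(-\pi/2,\pi/2)$. Then: (1) $F^{0,2}=0$ if and only if $C$ is Lagrangian with respect to $\omega$. (2) If $C$ is Lagrangian, then $C$ is special Lagrangian with phase $\theta$, i.e. $\operatorname{Im}\Omega|_C=\tan\theta\,\operatorname{Re}\Omega|_C$, if and only if $$\operatorname{Im}(\widetilde\omega+F)^m=\tan\theta\,\operatorname{Re}(\widetilde\omega+F)^m .$$ (3) If $C$ is special Lagrangian with phase $\theta$ and $\nabla=d+a$, $a=\sum_k a_k(x)\,dx^k$, is a flat unitary connection on a trivial Hermitian vector bundle of any rank $r\ge 1$ over $C$ (where $C$ is identified with $B$ by $\pi$; for $r=1$ one has $a=i\,de$ with $e$ a real function on $B$), then the connection $$D_A=d+i\sum_j y^j\,d\widetilde y_j\cdot \mathrm{Id}_r+a$$ on the trivial Hermitian rank $r$ bundle over $W$ (with $a$ pulled back to $W$ by the projection $W\to B$) has curvature $F_A$ satisfying $$F_A^{0,2}=0,\qquad \operatorname{Im}(\widetilde\omega+F_A)^m=\tan\theta\,\operatorname{Re}(\widetilde\omega+F_A)^m .$$ That is, the transform of a type-A supersymmetric section of $M$ is a type-B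 supersymmetric cycle with support all of $W$.
   Context: Semi-flat setting. $B\subset\mathbb R^m$ is an open ball with coordinates $x^1,\dots,x^m$, and $\phi:B\to\mathbb R$ is a smooth function with positive definite Hessian $\phi_{ij}=\partial^2\phi/\partial x^i\partial x^j$ satisfying the real Monge-Ampère equation $\det(\phi_{ij})=\mathrm{const}$; $(\phi^{ij})$ is the inverse matrix of $(\phi_{ij})$. $M=B\times T$, where $T=\mathbb R^m/\Lambda$ is a torus ($\Lambda$ a lattice) with coordinates $y^1,\dots,y^m$, and $\pi:M\to B$ is the projection. $M$ has complex coordinates $z^j=x^j+iy^j$, Kähler form $\omega=\frac i2\sum\phi_{ij}\,dz^i\wedge d\bar z^j$, and holomorphic volume form $\Omega=dz^1\wedge\dots\wedge dz^m$. The dual torus is $\widetilde T=\mathbb R^m/\Lambda^*$ with coordinates $\widetilde y_1,\dots,\widetilde y_m$, where $\Lambda^*=\{\widetilde y:\sum_j y^j\widetilde y_j\in2\pi\mathbb Z\ \text{for all } y\in\Lambda\}$, so that $y\in T$ corresponds to the flat $U(1)$ connection $d+i\sum y^jd\widetilde y_j$ on $\widetilde T$ (well defined up to gauge). The mirror is $W=B\times\widetilde T$. Put $\widetilde x_j=\partial\phi/\partial x^j$, so $d\widetilde x_j=\sum_k\phi_{jk}dx^k$; these are coordinates on $B$. $W$ has complex coordinates $\widetilde z_j=\widetilde x_j+i\widetilde y_j$, Kähler form $\widetilde\omega=\frac i2\sum\phi^{ij}\,d\widetilde z_i\wedge d\overline{\widetilde z}_j$, and holomorphic volume form $\widetilde\Omega=d\widetilde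 z_1\wedge\dots\wedge d\widetilde z_m$. Curvatures of unitary connections are skew-Hermitian (purely imaginary in rank one). In rank one $\operatorname{Re}$ and $\operatorname{Im}$ are the ordinary real and imaginary parts of complex-valued differential forms; for matrix-valued forms, $\operatorname{Re}$ is the Hermitian part and $\operatorname{Im}$ is the skew-Hermitian part divided by $i$. A type-A supersymmetric section is a special Lagrangian section $C$ of $\pi$ together with a flat unitary connection over it. A type-B supersymmetric cycle supported on $W$ is a unitary connection on a vector bundle over $W$ whose curvature $F$ satisfies $F^{0,2}=0$ and the deformed Hermitian-Yang-Mills equation $\operatorname{Im}(\widetilde\omega+F)^m=\tan\theta\operatorname{Re}(\widetilde\omega+F)^m$ for some constant $\theta$. *)

(* Defs.v *)
From mathcomp Require Import all_boot all_order all_algebra.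
From mathcomp Require Import complex.
From mathcomp Require Import boolp classical_sets functions reals topology.
From mathcomp Require Import normedtype derive trigo.

Set Implicit Arguments.
Unset Strict Implicit.
Unset Printing Implicit Defensive.

Import Order.TTheory GRing.Theory Num.Theory.
Import numFieldNormedType.Exports.
Local Open Scope complex_scope.
Local Open Scope ring_scope.

Definition pder (R : realType) (n : nat) (i : 'I_n) (f : 'rV[R]_n -> R) :
  'rV[R]_n -> R := fun x => 'D_(delta_mx 0 i) f x.

Fixpoint Ck (R : realType) (n k : nat) (U : set 'rV[R]_n)
    (f : 'rV[R]_n -> R) : Prop :=
  (forall x, U x -> {for x, continuous f}) /\
  match k with
  | 0 => True
  | k'.+1 => forall i : 'I_n,
      (forall x, U x -> derivable f x (delta_mx 0 i)) /\ Ck k' U (pder i f)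
  end.

(* Meaningful for U open; only the values of f on U matter. *)
Definition smooth_on (R : realType) (n : nat) (U : set 'rV[R]_n)
  (f : 'rV[R]_n -> R) : Prop := forall k, Ck k U f.

(* The library norm on 'rV[R]_n is the sup norm, so the Euclidean ball is
   written out. *)
Definition open_ball (R : realType) (n : nat) (c : 'rV[R]_n) (rho : R) :
  set 'rV[R]_n := [set x | \sum_i (x 0 i - c 0 i) ^+ 2 < rho ^+ 2]%classic.

Definition hessian (R : realType) (n : nat) (phi : 'rV[R]_n -> R)
  (x : 'rV[R]_n) : 'M[R]_n := \matrix_(i, j) pder i (pder j phi) x.

Definition posdefmx (R : realType) (n : nat) (H : 'M[R]_n) : Prop :=
  H^T = H /\ forall v : 'rV[R]_n, v != 0 -> 0 < (v *m H *m v^T) 0 0.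

Definition pderC (R : realType) (n : nat) (i : 'I_n) (f : 'rV[R]_n -> R[i]) :
  'rV[R]_n -> R[i] :=
  fun x => pder i (fun z => complex.Re (f z)) x
        +i* pder i (fun z => complex.Im (f z)) x.

Definition pderM (R : realType) (n r : nat) (i : 'I_n)
  (f : 'rV[R]_n -> 'M[R[i]]_r) : 'rV[R]_n -> 'M[R[i]]_r :=
  fun x => \matrix_(a, b) pderC i (fun z => f z a b) x.

(* [ext n A] is the exterior algebra on generators e_0, ..., e_(n-1) with
   coefficients in A: the value at S is the coefficient of the wedge product
   of the e_i, i in S, taken in increasing order. A differential form on an
   open subset of R^n is a function into [ext n A], e_i standing for the
   differential of the i-th real coordinate. *)

Definition ext (n : nat) (A : pzRingType) := {ffun {set 'I_n} -> A}.

Section Exterior.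
Variables (n : nat) (A : pzRingType).

(* Number of transpositions needed to sort S followed by T. *)
Definition inversions (S T : {set 'I_n}) : nat :=
  #|[set p : 'I_n * 'I_n | [&& p.1 \in S, p.2 \in T & (p.2 < p.1)%N]]|.

Definition wedge (u v : ext n A) : ext n A :=
  [ffun S : {set 'I_n} => \sum_(T : {set 'I_n} | T \subset S)
     (-1) ^+ inversions T (S :\: T) * (u T * v (S :\: T))].

Definition eone : ext n A := [ffun S : {set 'I_n} => (S == finset.set0)%:R].

Definition egen (i : 'I_n) : ext n A :=
  [ffun S : {set 'I_n} => (S == [set i]%SET)%:R].

Definition escale (a : A) (u : ext n A) : ext n A := [ffun S => a * u S].

Definition epow (u : ext n A) (k : nat) : ext n A := iter k (wedge u) eone.

(* Exterior derivative, [pd i] being the i-th partial derivative of A-valued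
   functions. *)
Definition ext_d (R : realType)
    (pd : 'I_n -> ('rV[R]_n -> A) -> 'rV[R]_n -> A)
    (u : 'rV[R]_n -> ext n A) (x : 'rV[R]_n) : ext n A :=
  [ffun S : {set 'I_n} => \sum_(i in S)
     (-1) ^+ inversions [set i]%SET (S :\ i) *
     pd i (fun z => u z (S :\ i)) x].

(* Curvature of the connection d + a. *)
Definition curvature (R : realType)
    (pd : 'I_n -> ('rV[R]_n -> A) -> 'rV[R]_n -> A)
    (a : 'rV[R]_n -> ext n A) (x : 'rV[R]_n) : ext n A :=
  ext_d pd a x + wedge (a x) (a x).

End Exterior.

Definition emap (n : nat) (A A' : pzRingType) (f : A -> A') (u : ext n A) :
  ext n A' := [ffun S => f (u S)].

(* The e_i are real, so complex conjugation acts on coefficients only. *)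
Definition econj (R : realType) (n : nat) (u : ext n R[i]) : ext n R[i] :=
  emap (@conjc R) u.

Definition ediff (R : realType) (n : nat) (f : 'rV[R]_n -> R)
  (x : 'rV[R]_n) : ext n R[i] :=
  \sum_k escale (pder k f x)%:C (egen _ k).

Definition adjmx (R : realType) (r : nat) (X : 'M[R[i]]_r) : 'M[R[i]]_r :=
  map_mx (@conjc R) X^T.

Definition hermRe (R : realType) (r : nat) (X : 'M[R[i]]_r) : 'M[R[i]]_r :=
  (2^-1 : R[i]) *: (X + adjmx X).

Definition hermIm (R : realType) (r : nat) (X : 'M[R[i]]_r) : 'M[R[i]]_r :=
  ((2 * 'i)^-1 : R[i]) *: (X - adjmx X).

(* [dz] lists the differentials of the m complex coordinates, in the real
   coframe e_0, ..., e_(2m-1), at a point. Each e_k decomposes uniquely as a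
   combination of the dz_j (its (1,0)-part) and of their conjugates (its
   (0,1)-part). Expanding every product of e_k's accordingly splits a form
   into its (p,q)-parts. *)

Section Types.
Variables (R : realType) (m : nat) (dz : 'I_m -> ext (m + m) R[i]).

Definition coframe_mx : 'M[R[i]]_(m + m) :=
  col_mx (\matrix_(j < m, k < m + m) dz j [set k]%SET)
         (\matrix_(j < m, k < m + m) econj (dz j) [set k]%SET).

Definition part10 (k : 'I_(m + m)) : ext (m + m) R[i] :=
  \sum_j escale (invmx coframe_mx k (lshift m j)) (dz j).

Definition part01 (k : 'I_(m + m)) : ext (m + m) R[i] :=
  \sum_j escale (invmx coframe_mx k (rshift m j)) (econj (dz j)).

Definition pq_part (p q : nat) (u : ext (m + m) R[i]) : ext (m + m) R[i] :=
  \sum_(S : {set 'I_(m + m)})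
    \sum_(T : {set 'I_(m + m)} |
            [&& T \subset S, #|T| == p & #|S :\: T| == q])
      escale (u S)
        (\big[@wedge _ _/eone _ _]_(k in S)
           (if k \in T then part10 k else part01 k)).

Definition pq_partM (r p q : nat) (u : ext (m + m) 'M[R[i]]_r) :
  ext (m + m) 'M[R[i]]_r :=
  [ffun S => \matrix_(a, b) pq_part p q (emap (fun X : 'M_r => X a b) u) S].

End Types.

Definition is_lattice (R : realType) (m : nat) (L : set 'rV[R]_m) : Prop :=
  exists2 E : 'M[R]_m, E \in unitmx &
    L = [set v | exists n : 'rV[int]_m, v = map_mx intr n *m E]%classic.

Definition dual_lattice (R : realType) (m : nat) (L : set 'rV[R]_m) :
  set 'rV[R]_m :=
  [set v | forall u, L u ->
     exists k : int, \sum_j u 0 j * v 0 j = 2 * pi * k%:~R]%classic.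

(* R^m / L, as the type of cosets of L. *)
Record torus (R : realType) (m : nat) (L : set 'rV[R]_m) := Torus {
  coset : set 'rV[R]_m;
  cosetP : exists u, coset = [set u + v | v in L]%classic }.

Definition tclass (R : realType) (m : nat) (L : set 'rV[R]_m) (u : 'rV[R]_m) :
  torus L := Torus (ex_intro _ u erefl).

Definition trepr (R : realType) (m : nat) (L : set 'rV[R]_m) (t : torus L) :
  'rV[R]_m := projT1 (cid (cosetP t)).

(* R^m x (R^m / L); the manifolds of interest are the open parts lying over
   an open subset of the first factor. Forms on it are functions to
   [ext (m + m) A], as its cotangent bundle is trivialised by the
   differentials of the base coordinates (indices [lshift m j]) and of the
   fibre coordinates (indices [rshift m j]). *)
Definition tfib (R : realType) (m : nat) (L : set 'rV[R]_m) : Type :=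
  ('rV[R]_m * torus L)%type.

Definition tproj (R : realType) (m : nat) (L : set 'rV[R]_m)
  (p : 'rV[R]_(m + m)) : tfib L := (lsubmx p, tclass L (rsubmx p)).

Definition tlift (R : realType) (m : nat) (L : set 'rV[R]_m) (w : tfib L) :
  'rV[R]_(m + m) := row_mx w.1 (trepr w.2).

(* Curvature is computed on the universal cover. *)
Definition tcurvature (R : realType) (m : nat) (L : set 'rV[R]_m)
    (A : pzRingType)
    (pd : 'I_(m + m) -> ('rV[R]_(m + m) -> A) -> 'rV[R]_(m + m) -> A)
    (a : tfib L -> ext (m + m) A) (w : tfib L) : ext (m + m) A :=
  curvature pd (fun p => a (tproj L p)) (tlift w).

Definition tsection (R : realType) (m : nat) (L : set 'rV[R]_m)
  (y : 'rV[R]_m -> 'rV[R]_m) : 'rV[R]_m -> tfib L :=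
  fun x => (x, tclass L (y x)).

(* Restriction of a form to the image of the section, i.e. its pull-back,
   written in the coordinates x. *)
Definition restrict (R : realType) (m : nat) (L : set 'rV[R]_m)
    (y : 'rV[R]_m -> 'rV[R]_m) (u : tfib L -> ext (m + m) R[i])
    (x : 'rV[R]_m) : ext m R[i] :=
  \sum_(S : {set 'I_(m + m)}) escale (u (tsection L y x) S)
    (\big[@wedge _ _/eone _ _]_(k in S)
       ediff (fun x' => (row_mx x' (y x')) 0 k) x).

(* M lies in [tfib L], with complex coordinates x^j + i y^j. *)

Definition dzM (R : realType) (m : nat) (j : 'I_m) : ext (m + m) R[i] :=
  egen _ (lshift m j) + escale 'i (egen _ (rshift m j)).

Definition omegaM (R : realType) (m : nat) (L : set 'rV[R]_m)
    (phi : 'rV[R]_m -> R) (w : tfib L) : ext (m + m) R[i] :=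
  escale ('i / 2) (\sum_i \sum_j escale (hessian phi w.1 i j)%:C
                     (wedge (dzM R i) (econj (dzM R j)))).

Definition OmegaM (R : realType) (m : nat) (L : set 'rV[R]_m) (w : tfib L) :
  ext (m + m) R[i] :=
  \big[@wedge _ _/eone _ _]_(j < m) dzM R j.

Definition lagrangian (R : realType) (m : nat) (L B : set 'rV[R]_m)
    (phi : 'rV[R]_m -> R) (y : 'rV[R]_m -> 'rV[R]_m) : Prop :=
  forall x, B x -> restrict y (@omegaM R m L phi) x = 0.

Definition phase_condition (R : realType) (m : nat) (L B : set 'rV[R]_m)
    (y : 'rV[R]_m -> 'rV[R]_m) (theta : R) : Prop :=
  forall x, B x ->
    emap (@complex.Im R) (restrict y (@OmegaM R m L) x) =
    escale (tan theta) (emap (@complex.Re R) (restrict y (@OmegaM R m L) x)).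

Definition special_lagrangian (R : realType) (m : nat) (L B : set 'rV[R]_m)
    (phi : 'rV[R]_m -> R) (y : 'rV[R]_m -> 'rV[R]_m) (theta : R) : Prop :=
  lagrangian L B phi y /\ phase_condition L B y theta.

(* The mirror W lies in [tfib (dual_lattice L)], with complex coordinates
   x~_j + i y~_j, where x~_j is the j-th partial derivative of phi. *)
Definition dzW (R : realType) (m : nat) (phi : 'rV[R]_m -> R) (x : 'rV[R]_m)
    (j : 'I_m) : ext (m + m) R[i] :=
  \sum_k escale (pder k (pder j phi) x)%:C (egen _ (lshift m k))
  + escale 'i (egen _ (rshift m j)).

Definition omegaW (R : realType) (m : nat) (L : set 'rV[R]_m)
    (phi : 'rV[R]_m -> R) (w : tfib (dual_lattice L)) : ext (m + m) R[i] :=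
  escale ('i / 2) (\sum_i \sum_j escale (invmx (hessian phi w.1) i j)%:C
                     (wedge (dzW phi w.1 i) (econj (dzW phi w.1 j)))).

(* Connection form of the transform of the section y. *)
Definition fm_form (R : realType) (m : nat) (L : set 'rV[R]_m)
    (y : 'rV[R]_m -> 'rV[R]_m) (w : tfib (dual_lattice L)) :
  ext (m + m) R[i] :=
  escale 'i (\sum_j escale (y w.1 0 j)%:C (egen _ (rshift m j))).

Definition fm_curvature (R : realType) (m : nat) (L : set 'rV[R]_m)
    (y : 'rV[R]_m -> 'rV[R]_m) (w : tfib (dual_lattice L)) :
  ext (m + m) R[i] :=
  tcurvature (@pderC R (m + m)) (@fm_form R m L y) w.

Definition dHYM (R : realType) (m : nat) (L B : set 'rV[R]_m)
    (phi : 'rV[R]_m -> R) (F : tfib (dual_lattice L) -> ext (m + m) R[i])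
    (theta : R) : Prop :=
  forall w, B w.1 ->
    emap (@complex.Im R) (epow (omegaW phi w + F w) m) =
    escale (tan theta) (emap (@complex.Re R) (epow (omegaW phi w + F w) m)).

(* d + a is a smooth unitary connection on the trivial bundle over U. *)
Definition unitary_connection (R : realType) (n r : nat) (U : set 'rV[R]_n)
    (a : 'rV[R]_n -> ext n 'M[R[i]]_r) : Prop :=
  [/\ forall x (S : {set 'I_n}), U x -> #|S| != 1%N -> a x S = 0,
      forall x (S : {set 'I_n}), U x -> adjmx (a x S) = - a x S
    & forall (S : {set 'I_n}) i j, smooth_on U (fun x => complex.Re (a x S i j)) /\
                    smooth_on U (fun x => complex.Im (a x S i j))].

(* The 1-form sum_k a_k dx^k on the base. *)
Definition base_form (R : realType) (m r : nat)
    (a : 'I_m -> 'rV[R]_m -> 'M[R[i]]_r) (x : 'rV[R]_m) :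
  ext m 'M[R[i]]_r := \sum_k escale (a k x) (egen _ k).

Definition flat_unitary (R : realType) (m r : nat) (B : set 'rV[R]_m)
    (a : 'I_m -> 'rV[R]_m -> 'M[R[i]]_r) : Prop :=
  unitary_connection B (base_form a) /\
  forall x, B x -> curvature (@pderM R m r) (base_form a) x = 0.

(* Connection form i sum_j y^j dy~_j Id_r + sum_k a_k dx^k on W. *)
Definition fm_formA (R : realType) (m r : nat) (L : set 'rV[R]_m)
    (y : 'rV[R]_m -> 'rV[R]_m) (a : 'I_m -> 'rV[R]_m -> 'M[R[i]]_r)
    (w : tfib (dual_lattice L)) : ext (m + m) 'M[R[i]]_r :=
  emap (@scalar_mx _ r) (fm_form y w) +
  \sum_k escale (a k w.1) (egen _ (lshift m k)).

(* The connection d + A on the trivial bundle of rank r over W is a type-B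
   supersymmetric cycle, with phase theta. *)
Definition type_B_cycle (R : realType) (m r : nat) (L B : set 'rV[R]_m)
    (phi : 'rV[R]_m -> R)
    (A : tfib (dual_lattice L) -> ext (m + m) 'M[R[i]]_r)
    (theta : R) : Prop :=
  let F := tcurvature (@pderM R (m + m) r) A in
  [/\ unitary_connection [set p | B (lsubmx p)]%classic
        (fun p => A (tproj (dual_lattice L) p)),
      forall w, B w.1 -> pq_partM (dzW phi w.1) 0 2 (F w) = 0
    & forall w, B w.1 ->
        let Q := epow (emap (@scalar_mx _ r) (omegaW phi w) + F w) m in
        emap (@hermIm R r) Q =
        escale (tan theta)%:C%:M (emap (@hermRe R r) Q)].

(* Main.v *)
Require Import Defs.
From HB Require Import structures.
From mathcomp Require Import all_boot all_order all_algebra.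
From mathcomp Require Import complex ring.
From mathcomp Require Import all_classical all_reals all_analysis.
From mathcomp Require Import boolp classical_sets functions reals topology.
From mathcomp Require Import normedtype derive trigo.
Set Implicit Arguments.
Unset Strict Implicit.
Unset Printing Implicit Defensive.
Import Order.TTheory GRing.Theory Num.Theory.
Import numFieldNormedType.Exports.
Local Open Scope complex_scope.
Local Open Scope ring_scope.

(** The statement is pointwise linear algebra in the exterior algebra of a real
    coframe, except for the last assertion, which is the Poincare lemma.

    Let H be the Hessian of phi at x and Y the Jacobian of y, Y_jk = d_k y^j.
    On M one has omega = sum H_ij dx^i dy^j, so that its restriction to the
    section is sum (H Y)_ik dx^i dx^k ([restrict_omega]): the section is
    Lagrangian iff H Y is symmetric.  On W the curvature is
    F = i sum Y_jk dx^k dy~_j, with no term in dy~ dy~ since y depends on x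
    alone ([fm_curvatureE]).  As dx = H^-1 dx~ has (0,1)-part H^-1 zbar / 2 and
    dy~ has (0,1)-part (i/2) zbar, the (0,2)-part of F is
    - 1/4 sum (Y H^-1)_jl zbar_l zbar_j ([fm_curvature02]), which vanishes iff
    Y H^-1 is symmetric; since H is symmetric this is again the symmetry of
    H Y ([fm_curvature02_eq0]).

    For the phases, the restriction of Omega is
    prod_j (dx^j + i dy^j) = det (1 + i Y) dx^1 ... dx^m ([restrict_Omega]),
    while omega~ = sum dx^j dy~_j ([omegaW_E]) gives
    omega~ + F = sum (1 + i Y)_jk dx^k dy~_j, whose m-th power is
    (-1)^(m(m-1)/2) m! det (1 + i Y) times the real volume form
    ([omega_curvature_power]).  Both phase conditions are therefore conditions
    on the single complex number det (1 + i Y), up to a nonzero real factor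
    ([phase_condition_dHYM]).

    In higher rank, the cross terms of the curvature cancel because i y dy~ is
    scalar and a does not depend on the fibre, and the rest of a contributes
    its own curvature, which is 0; hence F_A = F Id ([fm_curvatureA]) and both
    equations reduce to those of rank one.  For r = 1 a flat unitary form is
    i times a closed real form on a ball, which is exact ([poincare_ball]).

    The exterior algebra is given the structure of an algebra, in which a form
    is pulled back by an algebra morphism [pull] sending each generator to a
    1-form; this one construction serves both for the restriction to the
    section and for the projection to the (0,2)-part. *)

(** * Alternating families in an algebra *)

(** The elements e_i square to zero and anticommute, like 1-forms. *)
Definition alt_family (I : Type) (A : pzRingType) (e : I -> A) :=
  (forall i, e i * e i = 0) /\ (forall i j, e i * e j = - (e j * e i)).

Lemma sorted_index_enum n : sorted ltn (map val (index_enum 'I_n)).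
Proof. by rewrite [index_enum _]unlock -enumT val_enum_ord iota_ltn_sorted. Qed.

Section AlternatingFamily.
Variables (n : nat) (A : pzRingType) (e : 'I_n -> A).
Hypothesis alt_e : alt_family e.

(** Moving e_k to its place in an increasing product costs one sign for each
    smaller index. *)
Lemma alternating_insert_seq (s : seq 'I_n) (S : {set 'I_n}) k :
    sorted ltn (map val s) -> k \in s -> k \notin S ->
  e k * \prod_(l <- s | l \in S) e l =
  (-1) ^+ count [pred l | (l \in S) && (l < k)%N] s
    * \prod_(l <- s | l \in k |: S) e l.
Proof.
elim: s => [//|a s IH] /= pas; rewrite finset.inE => ks kS.
have sortS := path_sorted pas.
have lta : forall l, l \in s -> (a < l)%N.
  move=> l ls; have := order_path_min ltn_trans pas.
  by move/allP/(_ (val l)); apply; apply: map_f.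
have [eqka|neqka] := eqVneq k a.
  subst a; rewrite !big_cons (negbTE kS) !finset.inE eqxx /= add0n.
  have -> : count [pred l | (l \in S) && (l < k)%N] s = 0%N.
    apply/eqP; rewrite -leqn0 leqNgt -has_count; apply/hasPn => l ls /=.
    by rewrite ltnNge (ltnW (lta _ ls)) andbF.
  rewrite expr0 mul1r; congr (_ * _).
  rewrite big_seq_cond [RHS]big_seq_cond; apply: eq_bigl => l.
  rewrite !finset.inE; case: (boolP (l \in s)) => //= ls.
  by case: eqVneq => // elk; move: (lta _ ls); rewrite elk ltnn.
have kins : k \in s by case/orP: ks => // /eqP ka; rewrite ka eqxx in neqka.
have altk : (a < k)%N by apply: lta.
rewrite !big_cons !finset.inE [a == k]eq_sym (negbTE neqka) /= altk andbT.
case: (boolP (a \in S)) => aS /=; last by rewrite add0n IH.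
rewrite mulrA alt_e.2 mulNr -mulrA IH // exprS mulN1r mulNr; congr (- _).
by rewrite !mulrA commr_sign.
Qed.

Lemma alternating_insert (S : {set 'I_n}) k : k \notin S ->
  e k * \prod_(l in S) e l =
  (-1) ^+ #|[set l in S | (l < k)%N]| * \prod_(l in k |: S) e l.
Proof.
move=> kS; rewrite alternating_insert_seq ?sorted_index_enum ?mem_index_enum //.
by congr ((-1) ^+ _ * _); rewrite cardE /enum_mem size_filter; apply: eq_count => l /=; rewrite finset.inE.
Qed.

Lemma alternating_insert0 (S : {set 'I_n}) k : k \in S ->
  e k * \prod_(l in S) e l = 0.
Proof.
move=> kS; have kS' : k \notin S :\ k by rewrite !finset.inE eqxx.
have /(congr1 (fun x => (-1) ^+ #|[set l in S :\ k | (l < k)%N]| * x)) :=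
  alternating_insert kS'.
rewrite mulrA -expr2 sqrr_sign mul1r finset.setD1K // => <-.
by rewrite mulrA commr_sign -mulrA (mulrA (e k)) alt_e.1 mul0r mulr0.
Qed.

(** Behind a factor c, terms annihilated by c may be dropped from each factor
    that follows. *)
Lemma mulr_prod_drop (I : Type) (r : seq I) (c : A) (b : I -> A) (t : I -> A) :
    (forall i, c * b i = - (b i * c)) -> (forall i, c * t i = 0) ->
  c * \prod_(i <- r) (b i + t i) = c * \prod_(i <- r) b i.
Proof.
move=> cb ct; elim: r => [|i r IH]; first by rewrite !big_nil.
by rewrite !big_cons !mulrA mulrDr ct addr0 cb !mulNr -!mulrA IH.
Qed.

End AlternatingFamily.

Lemma anticomm_prod (A : pzRingType) m (x : A) (a : 'I_m -> A) :
    (forall i, x * a i = - (a i * x)) ->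
  x * \prod_i a i = (-1) ^+ m * (\prod_i a i * x).
Proof.
move=> xa.
have szI : size (index_enum 'I_m) = m.
  by rewrite [index_enum _]unlock -enumT size_enum_ord.
rewrite -[X in (-1) ^+ X]szI => {szI}; elim: (index_enum _) => [|i r IH].
  by rewrite !big_nil mulr1 !mul1r.
rewrite !big_cons mulrA xa mulNr -mulrA IH exprS mulN1r mulNr; congr (- _).
by rewrite !mulrA commr_sign.
Qed.

Lemma alternating_prod_split (A : pzRingType) m (a b : 'I_m -> A) :
    (forall i j, b i * a j = - (a j * b i)) ->
  \prod_i (a i * b i) = (-1) ^+ 'C(m, 2) * (\prod_i a i * \prod_i b i).
Proof.
elim: m a b => [|m IH] a b ab.
  by rewrite !big_ord0 !mul1r.
rewrite !big_ord_recl IH => [|i j]; last exact: ab.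
rewrite [LHS]mulrA commr_sign -!mulrA [b ord0 * _]mulrA.
rewrite (anticomm_prod (fun i => ab ord0 _)) -!mulrA (mulrA (a ord0)).
by rewrite commr_sign binS bin1 exprD -!mulrA.
Qed.

(** The m-th power of a sum of m commuting elements of square zero only keeps
    their product; the next power vanishes. *)
Lemma expr_sum_sqr0 (A : pzRingType) m (t : 'I_m -> A) :
    (forall i, t i * t i = 0) -> (forall i j, GRing.comm (t i) (t j)) ->
  (\sum_i t i) ^+ m = (m`!)%:R * \prod_i t i.
Proof.
move=> t0 tc.
suff [] : (\sum_i t i) ^+ m = (m`!)%:R * \prod_i t i /\
          (\sum_i t i) ^+ m.+1 = 0 by [].
elim: m t t0 tc => [|m IH] t t0 tc.
  by rewrite !big_ord0 expr0 expr1 mulr1.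
set w := widen_ord (leqnSn m).
have [IH1 IH2] := IH (t \o w) (fun i => t0 _) (fun i j => tc _ _).
rewrite !big_ord_recr /=; set T := \sum_i _ in IH1 IH2 *; set x := t ord_max.
have cTx : GRing.comm T x.
  by apply: commr_sym; apply: commr_sum => i _; apply: tc.
have xk k : (1 < k)%N -> x ^+ k = 0.
  by case: k => [|[|k]] // _; rewrite !exprS mulrA t0 mul0r.
have Tk k : (m < k)%N -> T ^+ k = 0.
  by move=> mk; rewrite -(subnKC mk) exprD IH2 mul0r.
split; rewrite exprDn_comm //.
  rewrite (bigD1 (inord 1)) //= big1 ?addr0 => [|i].
    rewrite inordK // subSS subn0 IH1 expr1 bin1 -mulrA -(mulr_natl _ m.+1).
    by rewrite mulrA -natrM factS.
  rewrite -val_eqE /= inordK //; case: i => [[|[|i]] lti] //= _.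
    by rewrite subn0 Tk // mul0r mul0rn.
  by rewrite xk // mulr0 mul0rn.
apply: big1 => i _; case: i => [[|[|i]] lti] /=.
- by rewrite subn0 Tk // mul0r mul0rn.
- by rewrite subSS subn0 Tk // mul0r mul0rn.
- by rewrite xk // mulr0 mul0rn.
Qed.

Section AlternatingDet.
Variables (K : comNzRingType) (A : algType K).

Lemma alternating_comp (I J : Type) (f : J -> I) (e : I -> A) :
  alt_family e -> alt_family (e \o f).
Proof. by case=> e0 eN; split=> [i|i j]; [apply: e0 | apply: eN]. Qed.

Lemma alternating_lin (I : finType) (J : Type) (e : I -> A) (c : J -> I -> K) :
  alt_family e -> alt_family (fun j => \sum_i c j i *: e i).
Proof.
move=> [e0 eN].
have antisym (M N : I -> K) : (\sum_i M i *: e i) * (\sum_i N i *: e i) =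
    - ((\sum_i N i *: e i) * (\sum_i M i *: e i)).
  rewrite !mulr_suml -sumrN.
  under eq_bigr do rewrite mulr_sumr.
  under [RHS]eq_bigr do rewrite mulr_sumr -sumrN.
  rewrite exchange_big; apply: eq_bigr => i _; apply: eq_bigr => j _.
  by rewrite -!scalerAl -!scalerAr eN !scalerN !scalerA mulrC.
have sq0 (r : seq I) (M : I -> K) :
    (\sum_(i <- r) M i *: e i) * (\sum_(i <- r) M i *: e i) = 0.
  elim: r => [|i r IH]; first by rewrite big_nil mul0r.
  rewrite big_cons mulrDl !mulrDr IH addr0 -scalerAl -scalerAr e0 !scaler0 add0r.
  rewrite mulr_suml mulr_sumr -big_split big1 //= => j _.
  by rewrite -!scalerAl -!scalerAr eN !scalerN !scalerA mulrC addNr.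
by split=> [j|i j]; [apply: sq0 | apply: antisym].
Qed.

(** Products of linear combinations of an alternating family are computed by
    the determinant, by expansion along the first row. *)
Lemma alternating_det m (e : 'I_m -> A) (C : 'M[K]_m) : alt_family e ->
  \prod_j (\sum_k C j k *: e k) = \det C *: \prod_k e k.
Proof.
elim: m e C => [|m IH] e C alt_e.
  by rewrite !big_ord0 det_mx00 scale1r.
rewrite big_ord_recl mulr_suml (expand_det_row C ord0) scaler_suml.
apply: eq_bigr => k _; rewrite -scalerAl -scalerA; congr (_ *: _).
(* behind e_k, the other factors only see the minor of C without column k *)
pose C' := row' ord0 (col' k C).
have -> : e k * \prod_(j < m) (\sum_l C (lift ord0 j) l *: e l) =
    e k * \prod_(j < m) (\sum_l C' j l *: (e \o lift k) l).
  rewrite -[RHS](mulr_prod_drop _ (t := fun j => C (lift ord0 j) k *: e k)).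
  - congr (_ * _); apply: eq_bigr => j _.
    rewrite (bigD1_ord k) //= addrC; congr (_ + _).
    by apply: eq_bigr => l _; rewrite !mxE.
  - move=> j; rewrite mulr_sumr mulr_suml -sumrN; apply: eq_bigr => l _.
    by rewrite -scalerAr -scalerAl alt_e.2 scalerN.
  - by move=> j; rewrite -scalerAr alt_e.1 scaler0.
rewrite IH; last exact: alternating_comp.
rewrite -scalerAr /cofactor.
have -> : \prod_(l < m) (e \o lift k) l = \prod_(l in [set~ k]) e l.
  under [RHS]eq_bigl do rewrite !finset.inE.
  (* both products run over the increasing list of the indices other than k *)
  rewrite -big_filter -(big_map (lift k) xpredT e); apply: congr_big => //.
  apply: (inj_map val_inj).
  apply: (irr_sorted_eq ltn_trans ltnn).
  - rewrite -map_comp.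
    have -> : map (val \o lift k) (index_enum 'I_m) = map (bump k) (map val (index_enum 'I_m)).
      by rewrite -map_comp.
    rewrite sorted_map; apply: sub_sorted (sorted_index_enum m) => i j ij /=.
    by rewrite ltnNge leq_bump2 -ltnNge.
  - by rewrite sorted_map; apply: sorted_filter => [i j l|]; [apply: ltn_trans | rewrite -sorted_map sorted_index_enum].
  - move=> x; apply/mapP/mapP => [[i /mapP[j _ ->] ->] | [ i]].
      by exists (lift k j); rewrite // mem_filter mem_index_enum andbT eq_sym neq_lift.
    rewrite mem_filter eq_sym => /andP[/unlift_some[j -> _] _] ->.
    by exists (lift k j) => //; apply: map_f; rewrite mem_index_enum.
rewrite alternating_insert //; last by rewrite !finset.inE eqxx.
have -> : k |: [set~ k] = [set: 'I_m.+1] by rewrite finset.setUCr.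
have -> : #|[set l in [set~ k] | (l < k)%N]| = k.
  rewrite -sum1_card -[RHS]card_ord -sum1_card.
  rewrite (big_ord_widen m.+1 (fun=> 1%N)) ?(ltnW (ltn_ord k)) //.
  by apply: eq_bigl => l; rewrite !finset.inE -val_eqE /=; case: ltngtP.
under [in LHS]eq_bigl do rewrite finset.inE.
rewrite add0n mulrC -scalerA; congr (_ *: _).
by rewrite -[in LHS]signr_odd -[in RHS]signr_odd mulr_sign scaler_sign.
Qed.
End AlternatingDet.

(** * The exterior algebra *)

Lemma inversionsE n (S T : {set 'I_n}) :
  inversions S T = (\sum_(i in S) \sum_(j in T) (j < i))%N.
Proof.
rewrite /inversions -sum1_card pair_big /= big_mkcond [RHS]big_mkcond /=.
apply: eq_bigr => p _; rewrite finset.inE; case: (p.1 \in S) => //=.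
by case: (p.2 \in T) => //=; case: ltnP.
Qed.

Lemma sum_setU_disjoint n (S T : {set 'I_n}) (F : 'I_n -> nat) :
  [disjoint S & T] ->
  (\sum_(i in S :|: T) F i = \sum_(i in S) F i + \sum_(i in T) F i)%N.
Proof.
by move=> dST; rewrite -bigU //; apply: eq_bigl => i; rewrite !finset.inE.
Qed.

Lemma inversionsUl n (S T U : {set 'I_n}) : [disjoint S & T] ->
  inversions (S :|: T) U = (inversions S U + inversions T U)%N.
Proof. by move=> dST; rewrite !inversionsE sum_setU_disjoint. Qed.

Lemma inversionsUr n (S T U : {set 'I_n}) : [disjoint T & U] ->
  inversions S (T :|: U) = (inversions S T + inversions S U)%N.
Proof.
move=> dTU; rewrite !inversionsE -big_split; apply: eq_bigr => i _.
by rewrite sum_setU_disjoint.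
Qed.

Lemma inversions0l n (S : {set 'I_n}) : inversions finset.set0 S = 0%N.
Proof. by rewrite inversionsE big_set0. Qed.

Lemma inversions1l n (k : 'I_n) (S : {set 'I_n}) :
  inversions [set k] S = #|[set l in S | (l < k)%N]|.
Proof.
rewrite inversionsE big_set1 -sum1_card big_mkcond [RHS]big_mkcond /=.
by apply: eq_bigr => i _; rewrite finset.inE; case: (i \in S) => //=; case: ltnP.
Qed.

(** The exterior algebra over a commutative ring K, as an algebra: a copy of
    [ext n K] on which the product is [wedge], scaling is [escale] and 1 is
    [eone], all definitionally. *)
Definition extalg (n : nat) (K : comNzRingType) := ext n K.
HB.instance Definition _ n K := GRing.Zmodule.on (extalg n K).

Section Scale.
Variables (n : nat) (K : comNzRingType).
Implicit Types (a b : K) (u v : extalg n K).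

Lemma escaleA a b u : escale a (escale b u) = escale (a * b) u.
Proof. by apply/ffunP => S; rewrite !ffunE mulrA. Qed.

Lemma escale1 : left_id 1 (@escale n K).
Proof. by move=> u; apply/ffunP => S; rewrite !ffunE mul1r. Qed.

Lemma escaleDr : right_distributive (@escale n K) +%R.
Proof. by move=> a u v; apply/ffunP => S; rewrite !ffunE mulrDr. Qed.

Lemma escaleDl u a b : escale (a + b) u = escale a u + escale b u.
Proof. by apply/ffunP => S; rewrite !ffunE mulrDl. Qed.

HB.instance Definition _ := GRing.Zmodule_isLmodule.Build K (extalg n K)
  escaleA escale1 escaleDr escaleDl.

End Scale.

Section Ring.
Variables (n : nat) (K : comNzRingType).
Implicit Types (u v w : extalg n K) (S T U : {set 'I_n}).

(** The product of the generators e_i, i in S, in increasing order. *)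
Definition emono S : extalg n K := [ffun T => (T == S)%:R].

Lemma extalgZE (a : K) u S : (a *: u) S = a * u S.
Proof. by rewrite ffunE. Qed.

Lemma emonoE S T : emono S T = (T == S)%:R.
Proof. by rewrite ffunE. Qed.

Lemma ext_sum u : u = \sum_S u S *: emono S.
Proof.
apply/ffunP => S; rewrite sum_ffunE (bigD1 S) //= big1 => [|T neTS].
  by rewrite extalgZE emonoE eqxx addr0 mulr1.
by rewrite extalgZE emonoE eq_sym (negbTE neTS) mulr0.
Qed.

(** [wedge], with its type expressed in the algebra. *)
Definition emul u v : extalg n K := wedge u v.

Lemma emulE u v S : emul u v S = \sum_(T : {set 'I_n} | T \subset S)
     (-1) ^+ inversions T (S :\: T) * (u T * v (S :\: T)).
Proof. by rewrite /emul ffunE. Qed.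

Lemma emulDl : left_distributive emul +%R.
Proof.
move=> u v w; apply/ffunP => S; rewrite [RHS]ffunE !emulE -big_split.
by apply: eq_bigr => T _; rewrite ffunE mulrDl mulrDr.
Qed.

Lemma emulDr : right_distributive emul +%R.
Proof.
move=> u v w; apply/ffunP => S; rewrite [RHS]ffunE !emulE -big_split.
by apply: eq_bigr => T _; rewrite ffunE mulrDr mulrDr.
Qed.

Lemma emulZl a u v : emul (a *: u) v = a *: emul u v.
Proof.
apply/ffunP => S; rewrite extalgZE !emulE mulr_sumr; apply: eq_bigr => T _.
by rewrite extalgZE -mulrA mulrCA.
Qed.

Lemma emulZr a u v : emul u (a *: v) = a *: emul u v.
Proof.
apply/ffunP => S; rewrite extalgZE !emulE mulr_sumr; apply: eq_bigr => T _.
by rewrite extalgZE [RHS]mulrCA; congr (_ * _); apply: mulrCA.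
Qed.

Lemma emul0l u : emul 0 u = 0.
Proof. by rewrite -[X in emul X _](scale0r (0 : extalg n K)) emulZl scale0r. Qed.

Lemma emul0r u : emul u 0 = 0.
Proof. by rewrite -[X in emul _ X](scale0r (0 : extalg n K)) emulZr scale0r. Qed.

Lemma emul_suml I (r : seq I) (P : pred I) (F : I -> extalg n K) v :
  emul (\sum_(i <- r | P i) F i) v = \sum_(i <- r | P i) emul (F i) v.
Proof. by elim/big_rec2: _ => [|i x y _ <-]; rewrite ?emul0l ?emulDl. Qed.

Lemma emul_sumr I (r : seq I) (P : pred I) (F : I -> extalg n K) v :
  emul v (\sum_(i <- r | P i) F i) = \sum_(i <- r | P i) emul v (F i).
Proof. by elim/big_rec2: _ => [|i x y _ <-]; rewrite ?emul0r ?emulDr. Qed.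

Lemma emul_mono S T : emul (emono S) (emono T) =
  if [disjoint S & T] then (-1) ^+ inversions S T *: emono (S :|: T) else 0.
Proof.
have SUD U : S \subset U -> [disjoint S & U :\: S] * (S :|: (U :\: S) = U).
  move=> sSU; split; first by rewrite -setI_eq0 finset.setIDA setDIl finset.setDv finset.set0I.
  by apply/setP => i; rewrite !finset.inE; case: (boolP (i \in S)) => //= /(fintype.subsetP sSU).
have DUS : [disjoint S & T] -> (S :|: T) :\: S = T.
  by move=> dST; rewrite finset.setDUl finset.setDv finset.set0U; apply/finset.setDidPl; rewrite disjoint_sym.
apply/ffunP => U; rewrite emulE.
rewrite (eq_bigr (fun V => if (V == S) && (U :\: S == T) then
   (-1) ^+ inversions S T else 0)) => [|V sVU]; last first.
  rewrite !ffunE; case: eqVneq => [->|_]; last by rewrite mul0r mulr0.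
  by case: eqVneq => [->|_] /=; rewrite ?mulr1 ?mulr0.
rewrite -big_mkcondr /=.
case: ifP => [dST|ndST]; last first.
  rewrite [RHS]ffunE.
  apply: big1 => V /and3P[sVU /eqP eVS /eqP eT].
  by move: ndST; rewrite -eT (SUD _ _).1 // -eVS.
rewrite extalgZE emonoE; have [->|neU] := eqVneq U (S :|: T).
  rewrite (big_pred1 S) ?mulr1 // => V /=; rewrite DUS // eqxx andbT.
  by case: eqVneq => [->|_]; rewrite ?finset.subsetUl ?andbF.
rewrite mulr0; apply: big1 => V /and3P[sVU /eqP eVS /eqP eT].
by move: neU; rewrite -eT (SUD _ _).2 ?eqxx // -eVS.
Qed.

Lemma emono0 : emono finset.set0 = eone n K.
Proof. by apply/ffunP => S; rewrite !ffunE. Qed.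

Lemma emono1 k : emono [set k] = egen K k.
Proof. by apply/ffunP => S; rewrite !ffunE. Qed.

Lemma emul1l : left_id (eone n K) emul.
Proof.
move=> u; rewrite {2}(ext_sum u) {1}(ext_sum u) emul_sumr.
apply: eq_bigr => S _; rewrite emulZr -emono0 emul_mono.
by rewrite -setI_eq0 finset.set0I eqxx inversions0l scale1r finset.set0U.
Qed.

Lemma emul1r : right_id (eone n K) emul.
Proof.
move=> u; rewrite {2}(ext_sum u) {1}(ext_sum u) emul_suml.
apply: eq_bigr => S _; rewrite emulZl -emono0 emul_mono.
rewrite -setI_eq0 finset.setI0 eqxx inversionsE big1 => [|i _]; last by rewrite big_set0.
by rewrite scale1r finset.setU0.
Qed.

(** By bilinearity it is enough to compare the signs on three monomials. *)
Lemma emulA : associative emul.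
Proof.
move=> u v w.
rewrite (ext_sum u) (ext_sum v) (ext_sum w).
rewrite !emul_suml; apply: eq_bigr => S _; rewrite !emulZl; congr (_ *: _).
rewrite [LHS]emul_sumr
  [X in _ = emul X _]emul_sumr [RHS]emul_suml; apply: eq_bigr => T _.
rewrite emulZl !emulZr emulZl; congr (_ *: _).
rewrite !emul_sumr; apply: eq_bigr => U _; rewrite !emulZr; congr (_ *: _).
rewrite !emul_mono.
have disjUl (X Y Z : {set 'I_n}) :
    [disjoint X :|: Y & Z] = [disjoint X & Z] && [disjoint Y & Z].
  by rewrite -!setI_eq0 finset.setIUl finset.setU_eq0.
have disjUr (X Y Z : {set 'I_n}) :
    [disjoint X & Y :|: Z] = [disjoint X & Y] && [disjoint X & Z].
  by rewrite -!setI_eq0 finset.setIUr finset.setU_eq0.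
case: (boolP [disjoint T & U]) => dTU; case: (boolP [disjoint S & T]) => dST;
  rewrite ?emul0l ?emul0r ?emulZl ?emulZr ?emul_mono ?disjUl ?disjUr
    ?dTU ?dST ?(negbTE dTU) ?(negbTE dST) ?andbF ?scaler0 //=.
rewrite andbT; case: ifP => dSU; rewrite ?scaler0 //.
rewrite !scalerA -!exprD finset.setUA inversionsUl // inversionsUr //.
by congr (_ ^+ _ *: _); rewrite addnC addnA.
Qed.

End Ring.

Lemma eone_neq0 n (K : comNzRingType) : eone n K != 0.
Proof.
apply/eqP => /ffunP /(_ finset.set0); rewrite !ffunE eqxx => /eqP.
by rewrite oner_eq0.
Qed.

HB.instance Definition _ n (K : comNzRingType) :=
  GRing.Zmodule_isNzRing.Build (extalg n K) (@emulA n K) (@emul1l n K)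
    (@emul1r n K) (@emulDl n K) (@emulDr n K) (@eone_neq0 n K).
HB.instance Definition _ n (K : comNzRingType) :=
  GRing.LSemiModule_isLSemiAlgebra.Build K (extalg n K)
    (fun a u v => esym (emulZl a u v)).
HB.instance Definition _ n (K : comNzRingType) :=
  GRing.LSemiAlgebra_isSemiAlgebra.Build K (extalg n K)
    (fun a u v => esym (emulZr a u v)).

Section Generators.
Variables (n : nat) (K : comNzRingType).
Implicit Types (S T : {set 'I_n}) (u v : extalg n K).

(** The generators of the algebra. *)
Definition gen (k : 'I_n) : extalg n K := egen K k.

Lemma genE k : gen k = emono K [set k].
Proof. by rewrite emono1. Qed.

Lemma emonoM S T : emono K S * emono K T =
  if [disjoint S & T] then (-1) ^+ inversions S T *: emono K (S :|: T) else 0.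
Proof. exact: emul_mono. Qed.

Lemma genM i j : gen i * gen j =
  if i == j then 0 else (-1) ^+ (j < i)%N *: emono K [set i; j].
Proof.
rewrite !genE emonoM disjoints1 finset.inE eq_sym; case: eqVneq => //= _.
by rewrite inversionsE !big_set1.
Qed.

Lemma alternating_gen : alt_family gen.
Proof.
split=> [i|i j]; rewrite !genM ?eqxx // [j == i]eq_sym.
case: eqVneq => [_|neij]; first by rewrite oppr0.
rewrite finset.setUC -scaleNr; congr (_ *: _).
move: neij; rewrite -val_eqE /=.
by case: ltngtP => //= _ _; rewrite ?expr0 ?expr1 ?opprK.
Qed.

Lemma prod_gen S : \prod_(k in S) gen k = emono K S.
Proof.
have [N] := ubnP #|S|; elim: N S => // N IH S.
have [->|[k kS]] := set_0Vmem S; first by rewrite big_set0 emono0.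
rewrite (cardsD1 k) kS add1n !ltnS => leN.
have kS' : k \notin S :\ k by rewrite !finset.inE eqxx.
have := alternating_insert alternating_gen kS'.
rewrite (IH _ leN) finset.setD1K // genE emonoM disjoints1 kS' finset.setD1K //.
rewrite inversions1l.
rewrite -[in X in X -> _]signr_odd -[in X in _ = X -> _]signr_odd.
rewrite mulr_sign scaler_sign => /esym.
by case: (odd _) => // /oppr_inj.
Qed.

Lemma ext_sumE u : u = \sum_S u S *: \prod_(k in S) gen k.
Proof. by rewrite {1}(ext_sum u); apply: eq_bigr => S _; rewrite prod_gen. Qed.

End Generators.

Section Pullback.
Variables (n : nat) (K : comNzRingType) (A : algType K) (eta : 'I_n -> A).
Hypothesis alt_eta : alt_family eta.

(** The linear map to A taking the generator e_k to eta_k and monomials to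
    increasing products; it is an algebra morphism when eta is alternating. *)
Definition pull (u : extalg n K) : A := \sum_S u S *: \prod_(k in S) eta k.

Lemma pull_is_linear a (u v : extalg n K) : pull (a *: u + v) = a *: pull u + pull v.
Proof.
rewrite /pull scaler_sumr -big_split; apply: eq_bigr => S _.
by rewrite !ffunE scalerDl scalerA.
Qed.

HB.instance Definition _ :=
  GRing.isLinear.Build K (extalg n K) A *:%R pull pull_is_linear.

Lemma pull_mono S : pull (emono K S) = \prod_(k in S) eta k.
Proof.
rewrite /pull (bigD1 S) //= [X in _ + X]big1 => [|T neTS]; rewrite emonoE.
  by rewrite eqxx scale1r addr0.
by rewrite (negbTE neTS) scale0r.
Qed.

Lemma pull1 : pull 1 = 1.
Proof. by rewrite -[1](emono0 n K) pull_mono big_set0. Qed.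

Lemma pull_gen k : pull (gen K k) = eta k.
Proof. by rewrite genE pull_mono big_set1. Qed.

Lemma pull_genM k v : pull (gen K k * v) = eta k * pull v.
Proof.
rewrite (ext_sum v) mulr_sumr !linear_sum mulr_sumr; apply: eq_bigr => S _.
rewrite -scalerAr !linearZ -scalerAr /=; congr (_ *: _).
rewrite genE emonoM disjoints1 pull_mono.
case: (boolP (k \in S)) => kS /=.
  by rewrite alternating_insert0 // linear0.
rewrite linearZ /= pull_mono alternating_insert // inversions1l.
by rewrite -[in LHS]signr_odd -[in RHS]signr_odd mulr_sign scaler_sign.
Qed.

Lemma pullM u v : pull (u * v) = pull u * pull v.
Proof.
rewrite {1}(ext_sumE u) mulr_suml linear_sum mulr_suml; apply: eq_bigr => S _.
rewrite -!scalerAl linearZ /=; congr (_ *: _).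
elim: (index_enum _) => [|k r IH]; first by rewrite !big_nil !mul1r.
rewrite !big_cons; case: ifP => // _.
by rewrite -!mulrA pull_genM IH.
Qed.

Lemma pull_prod I (r : seq I) (F : I -> extalg n K) :
  pull (\prod_(i <- r) F i) = \prod_(i <- r) pull (F i).
Proof. by elim: r => [|i r IH]; rewrite ?big_nil ?pull1 // !big_cons pullM IH. Qed.

End Pullback.

Section Quadratic.
Variables (n : nat) (K : comNzRingType).

(** The quadratic expression sum_ij M_ij e_i e_j. *)
Definition quad (A : algType K) (e : 'I_n -> A) (M : 'M[K]_n) : A :=
  \sum_i \sum_j M i j *: (e i * e j).

Lemma pull_quad (A : algType K) (eta : 'I_n -> A) M : alt_family eta ->
  pull eta (quad (gen K) M) = quad eta M.
Proof.
move=> alt_eta; rewrite linear_sum; apply: eq_bigr => i _.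
rewrite linear_sum; apply: eq_bigr => j _.
by rewrite linearZ /= pullM // !pull_gen.
Qed.

Lemma quad_coef M (a b : 'I_n) : (a < b)%N ->
  quad (gen K) M [set a; b] = M a b - M b a.
Proof.
move=> ltab; have neab : a != b by rewrite -val_eqE /= ltn_eqF.
rewrite /quad pair_bigA /= sum_ffunE.
rewrite (bigD1 (a, b)) //= (bigD1 (b, a)) /=; last first.
  by rewrite xpair_eqE negb_and eq_sym neab.
rewrite big1 => [|[i j] /= /andP[neij1 neij2]].
  rewrite addr0 !extalgZE !genM [b == a]eq_sym (negbTE neab) ltab.
  rewrite ltnNge ltnW //= !extalgZE !emonoE [[set b; a]]finset.setUC eqxx.
  by rewrite !mulr1 mulrN1.
rewrite extalgZE genM; case: eqVneq => neij; first by rewrite ffunE mulr0.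
rewrite extalgZE emonoE; case: eqP => [/setP eqS|_]; last by rewrite !mulr0.
have := eqS i; have := eqS j; rewrite !finset.inE !eqxx orbT /=.
case: (eqVneq i a) => [eia|nia]; case: (eqVneq i b) => [eib|nib] //;
case: (eqVneq j a) => [eja|nja]; case: (eqVneq j b) => [ejb|njb] // _ _; subst.
all: by rewrite ?eqxx in neij neij1 neij2 neab.
Qed.

Lemma quad_coef0 M (S : {set 'I_n}) : #|S| != 2 -> quad (gen K) M S = 0.
Proof.
move=> cS; rewrite /quad pair_bigA /= sum_ffunE big1 // => -[i j] _ /=.
rewrite extalgZE genM; case: eqVneq => neij; first by rewrite ffunE mulr0.
rewrite extalgZE emonoE; case: eqP => [eS|_]; last by rewrite !mulr0.
by rewrite eS cards2 neij in cS.
Qed.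

Lemma card2_ltP (S : {set 'I_n}) : #|S| = 2 ->
  exists a b : 'I_n, (a < b)%N /\ S = [set a; b].
Proof.
move=> /eqP/cards2P[a [b [neab ->]]].
have [ltab|ltba|/val_inj eab] := ltngtP a b; first by exists a, b.
  by exists b, a; rewrite finset.setUC.
by rewrite eab eqxx in neab.
Qed.

(** Two forms of degree two are equal if they agree on e_a e_b for a < b. *)
Lemma ext2P (A : pzRingType) (u v : ext n A) :
    (forall S : {set _}, #|S| != 2 -> u S = 0) ->
    (forall S : {set _}, #|S| != 2 -> v S = 0) ->
    (forall a b : 'I_n, (a < b)%N -> u [set a; b] = v [set a; b]) ->
  u = v.
Proof.
move=> u0 v0 uv; apply/ffunP => S.
have [/card2_ltP[a [b [ltab ->]]]|cS] := eqVneq #|S| 2; first exact: uv.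
by rewrite u0 ?v0.
Qed.

Lemma quad_eq0 M : quad (gen K) M = 0 <-> M^T = M.
Proof.
split=> [M0|symM].
  apply/matrixP => i j; rewrite mxE.
  suff H (a b : 'I_n) : (a < b)%N -> M a b = M b a.
    have [/H //|/H //|/val_inj -> //] := ltngtP i j.
  move=> ltab; apply/eqP; rewrite -subr_eq0 -quad_coef //.
  by rewrite M0 ffunE.
apply: ext2P => [S /quad_coef0 -> //|S _|a b ltab]; first by rewrite ffunE.
by rewrite quad_coef // ffunE -[in M b a]symM mxE subrr.
Qed.

Lemma quad_sym (A : algType K) (e : 'I_n -> A) M : alt_family e ->
  M^T = M -> quad e M = 0.
Proof. by move=> alt_e /quad_eq0 M0; rewrite -pull_quad // M0 linear0. Qed.

End Quadratic.

(** The top power of sum_jk C_jk e_k f_j, where e and f are the two halves of g: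
    it is the sum of the m commuting elements (sum_k C_jk e_k) f_j, each of
    square zero. *)
Lemma symplectic_power m (K : comNzRingType) (A : algType K)
    (g : 'I_(m + m) -> A) (C : 'M[K]_m) : alt_family g ->
  (\sum_j \sum_k C j k *: (g (lshift m k) * g (rshift m j))) ^+ m =
  ((-1) ^+ 'C(m, 2) * m`!%:R * \det C) *: \prod_i g i.
Proof.
move=> alt_g; pose e := g \o @lshift m m; pose f := g \o @rshift m m.
pose al j := \sum_k C j k *: e k.
have efN i j : e i * f j = - (f j * e i) by apply: alt_g.2.
have afN i j : al i * f j = - (f j * al i).
  rewrite /al mulr_suml mulr_sumr -sumrN; apply: eq_bigr => k _.
  by rewrite -scalerAl -scalerAr efN scalerN.
have [al0 alN] : alt_family al by apply/alternating_lin/alternating_comp.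
have [f0 fN] : alt_family f by apply: alternating_comp.
have -> : \sum_j \sum_k C j k *: (g (lshift m k) * g (rshift m j)) =
    \sum_j al j * f j.
  apply: eq_bigr => j _; rewrite mulr_suml; apply: eq_bigr => k _.
  by rewrite -scalerAl.
rewrite expr_sum_sqr0 => [|i|i j]; first 1 last.
- by rewrite -mulrA (mulrA (f i)) -[f i * _]opprK -afN mulNr -!mulrA f0 !mulr0 oppr0 mulr0.
- rewrite /GRing.comm.
  have mv (x y z t : A) : y * z = - (z * y) -> x * y * (z * t) = - (x * z * (y * t)).
    by move=> yz; rewrite -!mulrA (mulrA y) yz mulNr mulrN !mulrA.
  rewrite mv; last by rewrite afN opprK.
  rewrite [RHS]mv; last by rewrite afN opprK.
  by rewrite (alN j i) (fN j i) mulNr mulrN opprK.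
rewrite alternating_prod_split => [|i j]; last by rewrite afN opprK.
rewrite alternating_det; last exact: alternating_comp.
rewrite big_split_ord /= -scalerAl -!scalerAr -/e -/f.
rewrite mulrA -[(-1) ^+ _](rmorph_sign (in_alg A)) -[_%:R](rmorph_nat (in_alg A)).
rewrite -rmorphM /= mulr_algl scalerA; congr (_ *: _).
by rewrite mulrC [m`!%:R * _]mulrC.
Qed.

Section Analysis.
Local Open Scope classical_set_scope.
Local Open Scope ring_scope.

(** * Functions with continuous partial derivatives *)

Section Lines.
Variables (R : realType) (V : normedModType R) (f : V -> R) (x v : V).

(** The difference quotients along a line are those of the restriction to the
    line, so no differentiability is needed to identify the derivatives. *)
Lemma derive_line_quotient (s : R) :
  (fun h : R => h^-1 *: (((fun r : R => f (x + r *: v)) \o shift s) (h *: 1) -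
      f (x + s *: v))) =
  (fun h => h^-1 *: ((f \o shift (x + s *: v)) (h *: v) - f (x + s *: v))).
Proof.
apply/funext => h /=; rewrite [h *: 1]mulr1 scalerDl.
by rewrite addrCA addrA.
Qed.

Lemma derivable_line (s : R) :
  derivable (fun r : R => f (x + r *: v)) s 1 <-> derivable f (x + s *: v) v.
Proof. by rewrite /derivable derive_line_quotient. Qed.

Lemma derive_line (s : R) :
  'D_1 (fun r : R => f (x + r *: v)) s = 'D_v f (x + s *: v).
Proof. by rewrite /derive derive_line_quotient. Qed.

End Lines.

(** The mean value inequality for g(t) - c t between 0 and s, for s of any
    sign. *)
Lemma derivative_bound (R : realType) (g dg : R -> R) (c e s : R) :
    (forall t : R, `|t| <= `|s| -> is_derive t 1 g (dg t)) ->
    (forall t : R, `|t| <= `|s| -> `|dg t - c| <= e) ->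
  `|g s - g 0 - c * s| <= e * `|s|.
Proof.
move=> dgP dge.
have cg t : `|t| <= `|s| -> {for t, continuous g}.
  by move=> /dgP [dt _]; apply/differentiable_continuous/derivable1_diffP.
have cgW (a b : R) : (forall t, t \in `[a, b] -> `|t| <= `|s|) ->
    {within `[a, b], continuous g}.
  move=> H; apply: derivable_within_continuous => t /H ts.
  by have [] := dgP _ ts.
have [s0|s0] := leP 0 s.
  have inS t : t \in `[0, s] -> `|t| <= `|s|.
    by rewrite in_itv /= => /andP[t0 ts]; rewrite !ger0_norm.
  have [||t ts ->] := @MVT_segment R g dg 0 s s0; last first.
  - rewrite subr0 -mulrBl normrM ler_wpM2r //.
    by apply: dge; apply: inS.
  - exact: cgW.
  - by move=> t ts; apply: dgP; apply: inS; apply: subset_itv_oo_cc.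
have inS t : t \in `[s, 0] -> `|t| <= `|s|.
  rewrite in_itv /= => /andP[st t0].
  by rewrite (ler0_norm t0) (ltr0_norm s0) lerN2.
have [||t ts] := @MVT_segment R g dg s 0 (ltW s0); last first.
- rewrite sub0r => E.
  have -> : g s - g 0 - c * s = (dg t - c) * s.
    by rewrite -[g s - g 0]opprB E mulrN opprK mulrBl.
  by rewrite normrM ler_wpM2r //; apply/dge/inS.
- exact: cgW.
- by move=> t ts; apply: dgP; apply: inS; apply: subset_itv_oo_cc.
Qed.

Lemma cvg_sumR (R : realType) (T I : Type) (F : set_system T) {FF : Filter F}
    (r : seq I) (u : I -> T -> R) (l : I -> R) :
  (forall i, u i x @[x --> F] --> l i) ->
  \sum_(i <- r) u i x @[x --> F] --> \sum_(i <- r) l i.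
Proof. by move=> ul; apply: cvg_big => //; apply: add_continuous. Qed.

Section C1.
Variables (R : realType) (n : nat).
Implicit Types (f : 'rV[R]_n -> R) (x : 'rV[R]_n).

Lemma norm_rV_ge (v : 'rV[R]_n) i : `|v 0 i| <= `|v|.
Proof.
rewrite [leRHS]mx_normrE.
exact: (le_bigmax _ (fun i : 'I_1 * 'I_n => `|v i.1 i.2|) (0, i)).
Qed.

Lemma norm_rV_le (v : 'rV[R]_n) r : 0 <= r -> (forall i, `|v 0 i| <= r) -> `|v| <= r.
Proof.
move=> r0 vr; rewrite [leLHS]mx_normrE; apply/bigmax_leP; split=> // -[i j] _.
by rewrite ord1.
Qed.

(** Partial derivatives that exist near x and are continuous at x give a first
    order expansion at x: the coordinates are changed one at a time and the mean
    value inequality is applied to each change. *)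
Lemma C1_expansion f x : (\forall z \near x, forall i, derivable f z (delta_mx 0 i)) ->
    (forall i, {for x, continuous (pder i f)}) ->
  forall e, 0 < e -> \forall h \near (0 : 'rV[R]_n),
    `|f (h + x) - f x - \sum_i pder i f x * h 0 i| <= e * `|h|.
Proof.
move=> df cf e e0.
pose e' := e / n.+1%:R; have e'0 : 0 < e' by rewrite divr_gt0.
have : \forall z \near x, (forall i, derivable f z (delta_mx 0 i)) /\
    forall i, `|pder i f z - pder i f x| <= e'.
  near=> z; split; first by near: z.
  near: z; apply: filter_forall => i.
  have /cvgrPdist_le/(_ _ e'0) := cf i; apply: filterS => z.
  by rewrite distrC.
move=> /nbhs_ballP[d /= d0 dP].
apply/nbhs_ballP; exists d => //= h; rewrite -ball_normE /= sub0r normrN => hd.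
(* the first k coordinates of h, completed by zeros *)
pose hk (k : nat) : 'rV[R]_n := \row_i (if (i < k)%N then h 0 i else 0).
have hkn : hk n = h by apply/rowP => i; rewrite mxE ltn_ord.
have hk0 : hk 0%N = 0 by apply/rowP => i; rewrite !mxE.
have -> : f (h + x) - f x = \sum_(k < n) (f (hk k.+1 + x) - f (hk k + x)).
  rewrite -(big_mkord xpredT (fun k => f (hk k.+1 + x) - f (hk k + x))).
  by rewrite telescope_sumr // hkn hk0 add0r.
rewrite -sumrB; apply: le_trans (ler_norm_sum _ _ _) _.
apply: (@le_trans _ _ (\sum_(k < n) e' * `|h|)); last first.
  rewrite sumr_const card_ord -mulrnAl ler_wpM2r // /e' -mulr_natr.
  by rewrite mulrAC ler_pdivrMr // ler_pM2l // ler_nat.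
apply: ler_sum => k _.
have hkS : hk k.+1 + x = (hk k + x) + h 0 k *: delta_mx 0 k.
  apply/rowP => i; rewrite !mxE eqxx /= ltnS.
  rewrite -val_eqE /= addrAC; congr (_ + _).
  by have [ik|ik|/val_inj eik] := ltngtP i k; rewrite ?mulr0 ?addr0 ?mulr1 ?add0r ?eik //.
rewrite hkS.
have near_ball s : `|s| <= `|h 0 k| -> ball x d (hk k + x + s *: delta_mx 0 k).
  move=> sh; rewrite -ball_normE /=; apply: le_lt_trans hd.
  have -> : x - (hk k + x + s *: delta_mx 0 k) = - (hk k + s *: delta_mx 0 k).
    by rewrite addrAC [_ + x]addrC opprD addNKr.
  rewrite normrN; apply: norm_rV_le => // i; rewrite !mxE eqxx /= -val_eqE /=.
  have [ik|ik|/val_inj eik] := ltngtP i k.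
  - by rewrite mulr0 addr0 norm_rV_ge.
  - by rewrite mulr0 addr0 normr0.
  - by rewrite add0r mulr1 (le_trans sh) ?norm_rV_ge.
have := @derivative_bound R (fun s => f (hk k + x + s *: delta_mx 0 k))
  (fun s => pder k f (hk k + x + s *: delta_mx 0 k)) (pder k f x) e' (h 0 k).
rewrite scale0r addr0 => /(_ _ _)/le_trans; apply.
- move=> t /near_ball/dP[dfk _]; apply: DeriveDef; first exact/derivable_line.
  exact: derive_line.
- by move=> t /near_ball/dP[_]; apply.
- by rewrite ler_wpM2l ?norm_rV_ge // ltW.
Unshelve. all: by end_near. Qed.

(** The candidate differential of f at x, as a linear form. *)
Definition gradient_form f x (h : 'rV[R]_n) : R := \sum_i pder i f x * h 0 i.

Lemma gradient_form_linear f x : linear (gradient_form f x).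
Proof.
move=> a u v; rewrite /gradient_form scaler_sumr -big_split; apply: eq_bigr => i _.
by rewrite !mxE mulrDr mulrCA.
Qed.

HB.instance Definition _ f x :=
  GRing.isLinear.Build R 'rV[R]_n R *:%R (gradient_form f x) (gradient_form_linear f x).

Lemma C1_diff f x : (\forall z \near x, forall i, derivable f z (delta_mx 0 i)) ->
    (forall i, {for x, continuous (pder i f)}) ->
  differentiable f x /\ 'd f x = gradient_form f x :> (_ -> _).
Proof.
move=> df cf.
have gc : continuous (gradient_form f x).
  move=> z; apply: (@cvg_sumR _ _ _ (nbhs z)) => i; apply: cvgM; first exact: cvg_cst.
  exact: coord_continuous.
have E : forall e, 0 < e -> \forall h \near (0 : 'rV[R]_n),
    `|(f \o shift x - (cst (f x) + gradient_form f x)) h| <= e * `|id h|.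
  move=> e e0; have := C1_expansion df cf e0.
  by apply: filterS => h; rewrite /= opprD addrA.
have dE : 'd f x = gradient_form f x :> (_ -> _).
  by apply: (diff_unique gc); apply/eqaddoP.
split=> //; apply/diff_locallyP; rewrite dE; split=> //.
by apply/eqaddoP.
Qed.

Lemma C1_derive f x v : (\forall z \near x, forall i, derivable f z (delta_mx 0 i)) ->
    (forall i, {for x, continuous (pder i f)}) ->
  is_derive x v f (\sum_i pder i f x * v 0 i).
Proof.
move=> df cf; have [diff dE] := C1_diff df cf.
by apply: DeriveDef; [exact: diff_derivable | rewrite deriveE // dE].
Qed.

End C1.

(** * Smooth functions on open sets *)

Section Smooth.
Variables (R : realType) (n : nat) (U : set 'rV[R]_n).
Hypothesis openU : open U.
Implicit Types f g : 'rV[R]_n -> R.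

Lemma eq_on_near f g x : (forall z, U z -> f z = g z) -> U x ->
  \forall z \near x, f z = g z.
Proof.
by move=> fg Ux; apply: filterS fg _; apply: open_nbhs_nbhs.
Qed.

Lemma eq_on_continuous f g x : (forall z, U z -> f z = g z) -> U x ->
  {for x, continuous f} -> {for x, continuous g}.
Proof.
move=> fg Ux cf; rewrite /prop_for /continuous_at -fg //.
by apply: cvg_trans cf; apply: (@near_eq_cvg _ _ (nbhs x)); apply: eq_on_near fg Ux.
Qed.

Lemma Ck_eq_on k f g : (forall z, U z -> f z = g z) -> Ck k U f -> Ck k U g.
Proof.
elim: k f g => [|k IH] f g fg [cf dfk].
  by split=> // x Ux; exact: (eq_on_continuous fg Ux (cf x Ux)).
split=> [x Ux|i]; first exact: (eq_on_continuous fg Ux (cf x Ux)).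
have [df Cdf] := dfk i; split=> [x Ux|].
  by apply: near_eq_derivable (df x Ux); exact: eq_on_near fg Ux.
by apply: IH Cdf => z Uz; apply: near_eq_derive; exact: eq_on_near fg Uz.
Qed.

Lemma smooth_on_eq f g : (forall z, U z -> f z = g z) ->
  smooth_on U f -> smooth_on U g.
Proof. by move=> fg sf k; apply: Ck_eq_on (sf k). Qed.

Lemma smooth_on_continuous f x : smooth_on U f -> U x -> {for x, continuous f}.
Proof. by move=> /(_ 0%N) [cf _]; apply: cf. Qed.

Lemma smooth_on_derivable f x i : smooth_on U f -> U x ->
  derivable f x (delta_mx 0 i).
Proof. by move=> /(_ 1%N) [_ /(_ i) [df _]]; apply: df. Qed.

Lemma smooth_on_pder f i : smooth_on U f -> smooth_on U (pder i f).
Proof. by move=> sf k; have [_ /(_ i) []] := sf k.+1. Qed.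

Lemma smooth_on_derive f x v : smooth_on U f -> U x ->
  is_derive x v f (\sum_i pder i f x * v 0 i).
Proof.
move=> sf Ux; apply: C1_derive => [|i].
  have : \forall z \near x, U z by apply: open_nbhs_nbhs.
  by apply: filterS => z Uz i; apply: smooth_on_derivable.
by apply: smooth_on_continuous => //; apply: smooth_on_pder.
Qed.

(** Continuity of f is not assumed: it follows from that of its partial
    derivatives g_i. *)
Lemma smooth_on_gradient f (g : 'I_n -> 'rV[R]_n -> R) :
    (forall i, smooth_on U (g i)) ->
    (forall x i, U x -> is_derive x (delta_mx 0 i) f (g i x)) ->
  smooth_on U f.
Proof.
move=> sg dfg.
have dfE i z : U z -> g i z = pder i f z.
  by move=> Uz; have [_ <-] := dfg z i Uz.
have cf x : U x -> {for x, continuous f}.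
  move=> Ux; apply: differentiable_continuous.
  apply: (C1_diff _ _).1 => [|i].
    have : \forall z \near x, U z by apply: open_nbhs_nbhs.
    by apply: filterS => z Uz i; have [] := dfg z i Uz.
  apply: smooth_on_continuous Ux; apply: smooth_on_eq (sg i); exact: dfE.
case=> [|k]; split=> // i; split=> [x Ux|]; first by have [] := dfg x i Ux.
by apply: Ck_eq_on (sg i k); apply: dfE.
Qed.

End Smooth.

(** * The Poincare lemma on a ball *)

Section Ball.
Variables (R : realType) (n : nat) (c : 'rV[R]_n) (rho : R).

Lemma open_open_ball : open (open_ball c rho).
Proof.
have -> : open_ball c rho = (fun x : 'rV[R]_n => \sum_i (x 0 i - c 0 i) ^+ 2)
    @^-1` [set r | r < rho ^+ 2] by [].
apply: open_comp; last exact: open_lt.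
move=> x _; apply: (@cvg_sumR _ _ _ (nbhs x)) => i.
have H : (x' 0 i - c 0 i) @[x' --> x] --> x 0 i - c 0 i.
  by apply: cvgB; [apply: coord_continuous | apply: cvg_cst].
by under eq_cvg do rewrite expr2; rewrite expr2; apply: cvgM.
Qed.

(** The segment from the centre c (t = 0) to x (t = 1). *)
Definition ray (x : 'rV[R]_n) (t : R) := c + t *: (x - c).

Lemma ray_ball x t : open_ball c rho x -> 0 <= t <= 1 -> open_ball c rho (ray x t).
Proof.
rewrite /open_ball /= => Bx /andP[t0 t1].
apply: le_lt_trans Bx; apply: ler_sum => i _.
rewrite !mxE addrAC subrr add0r exprMn ler_piMl ?sqr_ge0 //.
by rewrite exprn_ile1.
Qed.

Lemma ray1 x : ray x 1 = x.
Proof. by rewrite /ray scale1r addrC subrK. Qed.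

End Ball.

Section Poincare.
Variables (R : realType) (n : nat) (c : 'rV[R]_n) (rho : R).
Let B := open_ball c rho.
Variable b : 'I_n -> 'rV[R]_n -> R.
Hypothesis smooth_b : forall j, smooth_on B (b j).
Hypothesis closed_b : forall i j x, B x -> pder i (b j) x = pder j (b i) x.

(** The 1-form sum b_j dx^j evaluated on the velocity of the ray to x. *)
Definition radial_integrand (x : 'rV[R]_n) (t : R) :=
  \sum_j b j (ray c x t) * (x - c) 0 j.

(** The integral of the 1-form along the ray to x. *)
Definition potential (x : 'rV[R]_n) : R :=
  \int[lebesgue_measure]_(t in `[0, 1]) radial_integrand x t.

Variables (x : 'rV[R]_n) (k : 'I_n).
Hypothesis Bx : B x.
Let e_k : 'rV[R]_n := delta_mx 0 k.

(* the derivative in s of the radial integrand at x + s e_k *)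
Let dintegrand (s t : R) := \sum_j
  (b j (ray c (x + s *: e_k) t) * (k == j)%:R +
   (x + s *: e_k - c) 0 j * (t * pder k (b j) (ray c (x + s *: e_k) t))).

Lemma sum_delta (F : 'I_n -> R) : \sum_i F i * e_k 0 i = F k.
Proof.
rewrite (bigD1 k) //= big1 => [|i neik]; rewrite !mxE eqxx /=.
  by rewrite eqxx mulr1 addr0.
by rewrite (negbTE neik) mulr0.
Qed.

Lemma is_derive_integrand (s t : R) : B (x + s *: e_k) -> 0 <= t <= 1 ->
  is_derive s 1 (fun s => radial_integrand (x + s *: e_k) t) (dintegrand s t).
Proof.
move=> Bs t01.
have Br := ray_ball Bs t01.
have rayE r : ray c (x + r *: e_k) t = ray c x t + r *: (t *: e_k).
  by rewrite /ray addrAC scalerDr addrA !scalerA mulrC.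
have db j : is_derive s 1 (fun r => b j (ray c (x + r *: e_k) t))
    (t * pder k (b j) (ray c (x + s *: e_k) t)).
  under eq_fun do rewrite rayE.
  rewrite rayE in Br *.
  have [d1 d2] := smooth_on_derive (@open_open_ball _ _ c rho) (t *: e_k) (smooth_b j) Br.
  apply: DeriveDef; first exact/derivable_line.
  rewrite derive_line d2 -[RHS](sum_delta (fun i => t * pder i (b j) _)).
  by apply: eq_bigr => i _; rewrite mxE mulrA [_ * t]mulrC.
have dx j : is_derive s 1 (fun r => (x + r *: e_k - c) 0 j) (k == j)%:R.
  have -> : (fun r : R => (x + r *: e_k - c) 0 j) =
      cst ((x - c) 0 j) + (k == j)%:R *: (@id R).
    by apply/funext => r; rewrite !mxE eqxx /= addrAC eq_sym mulrC.
  have := is_deriveD (is_derive_cst ((x - c) 0 j) s 1)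
    (is_deriveZ (k == j)%:R (is_derive_id s (1 : R))).
  by move=> /is_derive_eq; apply; rewrite add0r; apply: mulr1.
have -> : (fun r : R => radial_integrand (x + r *: e_k) t) =
    \sum_j (fun r => b j (ray c (x + r *: e_k) t) * (x + r *: e_k - c) 0 j).
  by apply/funext => r; rewrite fct_sumE.
apply: is_derive_sum => j.
exact: is_deriveM (db j) (dx j).
Qed.

Lemma near_ball_line : exists2 d : R, 0 < d &
  forall s, `|s| <= d -> B (x + s *: e_k).
Proof.
have : \forall s \near (0 : R), B (x + s *: e_k).
  have /(_ B) : x + s *: e_k @[s --> (0:R)] --> x.
    rewrite -[X in _ --> X]addr0 -(scale0r e_k); apply: cvgD; first exact: cvg_cst.
    by apply: cvgZl.
  apply; apply: open_nbhs_nbhs; split=> //; exact: open_open_ball.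
move=> /nbhs_ballP[d /= d0 dP]; exists (d / 2); first by rewrite divr_gt0.
move=> s sd; apply: dP; rewrite -ball_normE /= sub0r normrN.
by apply: le_lt_trans sd _; rewrite ltr_pdivrMr // ltr_pMr // ltr1n.
Qed.

Lemma cvg_ray (s t : R) : (ray c (x + p.1 *: e_k) p.2) @[p --> (s, t)] -->
  ray c (x + s *: e_k) t.
Proof.
rewrite /ray; apply: cvgD; first exact: cvg_cst.
apply: cvgZ; first exact: cvg_snd.
apply: cvgB; last exact: cvg_cst.
apply: cvgD; first exact: cvg_cst.
by apply: cvgZl; apply: cvg_fst.
Qed.

Lemma cvg_comp_ray (f : 'rV[R]_n -> R) (s t : R) : smooth_on B f ->
    B (x + s *: e_k) -> 0 <= t <= 1 ->
  f (ray c (x + p.1 *: e_k) p.2) @[p --> (s, t)] --> f (ray c (x + s *: e_k) t).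
Proof.
move=> sf Bs t01; apply: (cvg_comp _ _ (@cvg_ray s t)).
by apply: smooth_on_continuous sf _; apply: ray_ball.
Qed.

Lemma cvg_dintegrand (s t : R) : B (x + s *: e_k) -> 0 <= t <= 1 ->
  dintegrand p.1 p.2 @[p --> (s, t)] --> dintegrand s t.
Proof.
move=> Bs t01; apply: (@cvg_sumR _ _ _ (nbhs (s, t))) => j.
apply: cvgD; apply: cvgM; last 1 first.
- apply: cvgM; first exact: cvg_snd.
  by apply: cvg_comp_ray => //; apply: smooth_on_pder.
- exact: cvg_comp_ray.
- exact: cvg_cst.
- apply: (cvg_comp (fun p : R * R => x + p.1 *: e_k - c)
    (fun z : 'rV[R]_n => z 0 j)); last exact: coord_continuous.
  apply: cvgB; last exact: cvg_cst.
  apply: cvgD; first exact: cvg_cst.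
  by apply: cvgZl; apply: cvg_fst.
Qed.

Lemma dintegrand_bounded (d : R) : (forall s, `|s| <= d -> B (x + s *: e_k)) ->
  exists2 M, 0 <= M &
    forall s t, `|s| <= d -> 0 <= t <= 1 -> `|dintegrand s t| <= M.
Proof.
move=> dP.
pose K : set (R * R) := `[- d, d] `*` `[0, 1].
have cK : compact ((fun p => dintegrand p.1 p.2) @` K).
  apply: continuous_compact; last by apply: compact_setX; apply: segment_compact.
  apply: continuous_in_subspaceT => -[s t] /set_mem[/=]; rewrite !in_itv /= => sd t01.
  by apply: cvg_dintegrand => //; apply: dP; rewrite ler_norml.
have [M [_ MP]] := compact_bounded cK.
exists (`|M| + 1); first by rewrite addr_ge0.
move=> s t sd t01; apply: (MP (`|M| + 1)); first by rewrite ltr_pwDr // ler_norm.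
by exists (s, t) => //; split; rewrite /= in_itv //= -ler_norml.
Qed.

Lemma cvg_pair_cst (s t : R) : (s, r) @[r --> t] --> (s, t).
Proof.
by apply: (@cvg_pair _ _ _ (nbhs t) (nbhs s) (nbhs t));
  [exact: cvg_cst | exact: cvg_id].
Qed.

Lemma cvg_integrand (s t : R) : B (x + s *: e_k) -> 0 <= t <= 1 ->
  radial_integrand (x + s *: e_k) r @[r --> t] --> radial_integrand (x + s *: e_k) t.
Proof.
move=> Bs t01; apply: (@cvg_sumR _ _ _ (nbhs t) _ _
  (fun j r => b j (ray c (x + s *: e_k) r) * (x + s *: e_k - c) 0 j)) => j.
apply: (@cvgM _ _ (nbhs t)); last exact: cvg_cst.
exact: (cvg_comp (pair s) (fun p => b j (ray c (x + p.1 *: e_k) p.2))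
  (@cvg_pair_cst s t) (cvg_comp_ray (smooth_b j) Bs t01)).
Qed.

Lemma continuous_integrand s : B (x + s *: e_k) ->
  {within `[0, 1], continuous (radial_integrand (x + s *: e_k))}.
Proof.
move=> Bs; apply: continuous_in_subspaceT => t /set_mem /=.
by rewrite in_itv /=; apply: cvg_integrand.
Qed.

Lemma continuous_dintegrand : {within `[0, 1], continuous (dintegrand 0)}.
Proof.
have H (t : R) : 0 <= t <= 1 -> dintegrand 0 r @[r --> t] --> dintegrand 0 t.
  have B0 : B (x + 0 *: e_k) by rewrite scale0r addr0.
  move=> t01; exact: (cvg_comp (pair 0) (fun p => dintegrand p.1 p.2)
    (@cvg_pair_cst 0 t) (cvg_dintegrand B0 t01)).
by apply: continuous_in_subspaceT => t /set_mem /=; rewrite in_itv /=; apply: H.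
Qed.

(** This is where closedness enters: it turns the derivative of the radial
    integrand in direction k into the t-derivative of t b_k. *)
Lemma is_derive_primitive (t : R) : 0 <= t <= 1 ->
  is_derive t 1 (fun t => t * b k (ray c x t)) (dintegrand 0 t).
Proof.
move=> t01; have Br := ray_ball Bx t01.
have [d1 d2] := smooth_on_derive (@open_open_ball _ _ c rho) (x - c) (smooth_b k) Br.
have db : is_derive t 1 (fun t => b k (ray c x t))
    (\sum_i pder i (b k) (ray c x t) * (x - c) 0 i).
  by apply: DeriveDef; [exact/derivable_line | rewrite -d2; exact: derive_line].
have := is_deriveM (is_derive_id t (1 : R)) db.
move=> /is_derive_eq; apply.
rewrite /dintegrand scale0r addr0 big_split /= [LHS]addrC; congr (_ + _).
  rewrite -[LHS]/(b k (ray c x t) * 1) mulr1 (bigD1 k) //= eqxx mulr1 big1 ?addr0 // => j.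
  by rewrite eq_sym => /negbTE ->; rewrite mulr0.
rewrite -[LHS]/(t * _) mulr_sumr; apply: eq_bigr => j _.
by rewrite closed_b // [RHS]mulrCA [X in _ = t * X]mulrC.
Qed.

Lemma integral_dintegrand :
  \int[lebesgue_measure]_(t in `[0, 1]) dintegrand 0 t = b k x.
Proof.
pose H (t : R) := t * b k (ray c x t).
have dH (t : R) : t \in `[0, 1] -> is_derive t 1 H (dintegrand 0 t).
  by rewrite in_itv /=; apply: is_derive_primitive.
have cH (t : R) : t \in `[0, 1] -> H r @[r --> t] --> H t.
  by move=> /dH[dt _]; apply/differentiable_continuous/derivable1_diffP.
rewrite /Rintegral (@continuous_FTC2 _ _ H) //=.
- by rewrite /H ray1 mul1r mul0r subr0.
- exact: continuous_dintegrand.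
- split=> [t t01||].
  + by have [] := dH t (subset_itv_oo_cc t01).
  + by apply/cvg_at_right_filter/cH; rewrite in_itv /= lexx ler01.
  + by apply/cvg_at_left_filter/cH; rewrite in_itv /= lexx ler01.
- move=> t t01; rewrite derive1E.
  by have [_] := dH t (subset_itv_oo_cc t01).
Qed.

(** Differentiation under the integral sign, the derivative of the integrand
    being bounded by compactness near s = 0. *)
Lemma is_derive_potential : is_derive x e_k potential (b k x).
Proof.
have [d d0 dP] := near_ball_line.
have [M M0 MP] := dintegrand_bounded dP.
have dIt (s : R) : `]- d, d[%classic s -> `|s| <= d.
  by rewrite /= in_itv /= ler_norml => /andP[/ltW -> /ltW ->].
have I0 : `]- d, d[%classic (0 : R) by rewrite /= in_itv /= oppr_lt0 d0.
pose f s t := radial_integrand (x + s *: e_k) t.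
have intf s : `]- d, d[%classic s -> lebesgue_measure.-integrable `[0, 1] (EFin \o f s).
  move=> /dIt/dP Bs; apply: continuous_compact_integrable; first exact: segment_compact.
  exact: continuous_integrand.
have df s t : `]- d, d[%classic s -> `[0, 1]%classic t ->
    is_derive s 1 (f ^~ t) (dintegrand s t).
  by move=> /dIt/dP Bs; rewrite /= in_itv /=; apply: is_derive_integrand.
have derf s t : `]- d, d[%classic s -> `[0, 1]%classic t -> derivable (f ^~ t) s 1.
  by move=> Is It; have [] := df s t Is It.
have d1E s t : `]- d, d[%classic s -> `[0, 1]%classic t ->
    partial1of2 f s t = dintegrand s t.
  by move=> Is It; rewrite partial1of2E; have [_] := df s t Is It.
have intM : lebesgue_measure.-integrable `[0, 1] (EFin \o cst M).
  apply: continuous_compact_integrable; first exact: segment_compact.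
  by apply: continuous_subspaceT => ?; apply: cvg_cst.
have ubM s t : `]- d, d[%classic s -> `[0, 1]%classic t -> `|partial1of2 f s t| <= cst M t.
  by move=> Is It; rewrite d1E //; apply: MP; [apply: dIt | move: It; rewrite /= in_itv].
have mI : measurable (`[0, 1]%classic : set (measurableTypeR R)) by exact: measurable_itv.
have dF := @derivable_under_integral R _ _ lebesgue_measure f _ mI 0 _ _ I0
  intf derf (cst M) (fun=> M0) intM ubM.
have DF := @differentiation_under_integral R _ _ lebesgue_measure f _ mI 0 _ _ I0
  intf derf (cst M) (fun=> M0) intM ubM.
have x0 : x + 0 *: e_k = x by rewrite scale0r addr0.
apply: DeriveDef.
  by rewrite -[X in derivable _ X]x0; apply/derivable_line.
rewrite -[X in 'D__ _ X]x0 -derive_line -derive1E [LHS]DF -integral_dintegrand.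
by apply: eq_Rintegral => t /set_mem It; rewrite d1E.
Qed.

End Poincare.

Lemma poincare_ball (R : realType) n (c : 'rV[R]_n) (rho : R)
    (b : 'I_n -> 'rV[R]_n -> R) :
    (forall j, smooth_on (open_ball c rho) (b j)) ->
    (forall i j x, open_ball c rho x -> pder i (b j) x = pder j (b i) x) ->
  exists2 e, smooth_on (open_ball c rho) e &
    forall x i, open_ball c rho x -> pder i e x = b i x.
Proof.
move=> sb cb; exists (potential c b).
  by apply: (smooth_on_gradient (@open_open_ball _ _ c rho) sb) => x i;
    apply: is_derive_potential.
by move=> x i Bx; have [_] := is_derive_potential sb cb i Bx.
Qed.

End Analysis.

(** * Complex coefficients *)

Section Complex.
Variable R : realType.
Implicit Types (z : R[i]) (x : R).

Lemma Re_iM x : complex.Re ('i * x%:C) = 0.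
Proof. by rewrite -complexiE /= mul0r mul1r subr0 //= oppr0. Qed.

Lemma Im_iM x : complex.Im ('i * x%:C) = x.
Proof. by rewrite -complexiE /= mul0r mul1r add0r. Qed.

Lemma Re_rM x z : complex.Re (x%:C * z) = x * complex.Re z.
Proof. by case: z => a b /=; rewrite mul0r subr0. Qed.

Lemma Im_rM x z : complex.Im (x%:C * z) = x * complex.Im z.
Proof. by case: z => a b /=; rewrite mul0r addr0. Qed.

Lemma conjc_i : conjc ('i : R[i]) = - 'i.
Proof. by rewrite -complexiE; apply/eqP; rewrite eq_complex /= oppr0 !eqxx. Qed.

Lemma conjc_r x : conjc (x%:C) = x%:C.
Proof. by apply/eqP; rewrite eq_complex /= oppr0 !eqxx. Qed.

Lemma conjc_iM x : conjc ('i * x%:C) = - ('i * x%:C).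
Proof.
rewrite -complexiE; apply/eqP; rewrite eq_complex /=.
by rewrite mul0r mulr0 subrr oppr0 !eqxx.
Qed.

(** A real matrix, with complex coefficients. *)
Definition cmx p q (M : 'M[R]_(p, q)) : 'M[R[i]]_(p, q) := map_mx (real_complex R) M.

Lemma cmx_tr p q (M : 'M[R]_(p, q)) : cmx M^T = (cmx M)^T.
Proof. by apply/matrixP => i j; rewrite !mxE. Qed.

Lemma cmx_inj p q : injective (@cmx p q).
Proof. by move=> M N /matrixP E; apply/matrixP => i j; have := E i j; rewrite !mxE => -[]. Qed.

End Complex.

Section KahlerForm.
Variables (R : realType) (n : nat) (A : algType R[i]) (a b : 'I_n -> A).
Hypothesis alt_a : alt_family a.
Hypothesis alt_b : alt_family b.
Hypothesis ba : forall i j, b i * a j = - (a j * b i).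

(** With a = Re dz and b = Im dz, the Kahler form of a symmetric matrix M is
    sum M_ij a_i b_j: the terms in a_i a_j and in b_i b_j cancel. *)
Lemma kahler_form (M : 'M[R[i]]_n) : M^T = M ->
  ('i / 2) *: (\sum_i \sum_j M i j *: ((a i + 'i *: b i) * (a j - 'i *: b j))) =
  \sum_i \sum_j M i j *: (a i * b j).
Proof.
move=> symM.
have E i j : (a i + 'i *: b i) * (a j - 'i *: b j) =
    a i * a j + b i * b j - 'i *: (a i * b j) - 'i *: (a j * b i).
  rewrite mulrDl !mulrBr -!scalerAl -!scalerAr ba scalerN scalerA -expr2 sqrCi.
  rewrite scaleN1r opprK !addrA addrC !addrA [b i * b j + _]addrC.
  by rewrite !(addrAC _ (b i * b j)) (addrAC _ (- ('i *: _))).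
transitivity (('i / 2) *: (quad a M + quad b M -
    (2 * 'i) *: \sum_i \sum_j M i j *: (a i * b j))).
  congr (_ *: _); rewrite mulr_natl mulr2n scalerDl opprD !addrA.
  have {2}-> : \sum_i \sum_j M i j *: (a i * b j) = \sum_i \sum_j M i j *: (a j * b i).
    rewrite exchange_big; apply: eq_bigr => i _; apply: eq_bigr => j _.
    by rewrite -[in LHS]symM mxE.
  rewrite /quad !scaler_sumr -!sumrN -!big_split; apply: eq_bigr => i _ /=.
  rewrite !scaler_sumr -!sumrN -!big_split; apply: eq_bigr => j _ /=.
  by rewrite E !(scalerBr, scalerDr) !scalerA ['i * _]mulrC.
rewrite !quad_sym // !add0r scalerN scalerA -scaleNr.
have -> : - ('i / 2 * (2 * 'i)) = 1 :> R[i].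
  by rewrite mulrA divfK ?pnatr_eq0 // -expr2 sqrCi opprK.
by rewrite scale1r.
Qed.

End KahlerForm.

(** * Connection forms and curvature *)

Section Curvature.
Variables (R : realType) (n : nat) (A : pzRingType).
Variables (pd : 'I_n -> ('rV[R]_n -> A) -> 'rV[R]_n -> A).
Variables (a : 'rV[R]_n -> ext n A) (x : 'rV[R]_n).
Hypothesis pd0 : forall i, pd i (fun=> 0) x = 0.
Hypothesis a1 : forall z (S : {set 'I_n}), #|S| != 1%N -> a z S = 0.

(** The curvature of a 1-form has the components
    d_i a_j - d_j a_i + [a_i, a_j]; the coefficients need not commute. *)
Lemma curvature_coef (i j : 'I_n) : (i < j)%N ->
  curvature pd a x [set i; j] =
  pd i (fun z => a z [set j]) x - pd j (fun z => a z [set i]) x +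
  (a x [set i] * a x [set j] - a x [set j] * a x [set i]).
Proof.
move=> ltij; have neij : i != j by rewrite -val_eqE /= ltn_eqF.
have Di : [set i; j] :\ i = [set j].
  by apply/setP => k; rewrite !inE; case: eqVneq => // ->; rewrite (negbTE neij).
have Dj : [set i; j] :\ j = [set i].
  by rewrite finset.setUC; apply/setP => k; rewrite !inE; case: eqVneq => // ->; rewrite eq_sym (negbTE neij).
have invij : inversions [set i] [set j] = 0%N by rewrite inversionsE !big_set1 ltnNge ltnW.
have invji : inversions [set j] [set i] = 1%N by rewrite inversionsE !big_set1 ltij.
rewrite /curvature ffunE; congr (_ + _).
  rewrite ffunE big_setU1 ?inE //= big_set1 Di Dj invij invji.
  by rewrite expr0 expr1 mul1r mulN1r.
rewrite ffunE (bigD1 [set i]) ?finset.sub1set ?inE ?eqxx //=.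
rewrite (bigD1 [set j]) /=; last first.
  by rewrite finset.sub1set !inE eqxx orbT; apply/eqP => /finset.set1_inj E; rewrite E eqxx in neij.
rewrite Di Dj invij invji expr0 expr1 mul1r mulN1r.
rewrite big1 ?addr0 // => T /andP[/andP[sT neTi] neTj].
have [/eqP/cards1P[k Tk]|cT] := eqVneq #|T| 1%N; last by rewrite a1 // mul0r mulr0.
move: sT neTi neTj; rewrite Tk finset.sub1set !inE => /orP[] /eqP -> ; rewrite ?eqxx //.
Qed.

Lemma curvature_coef0 (S : {set 'I_n}) : #|S| != 2 -> curvature pd a x S = 0.
Proof.
move=> cS; rewrite /curvature ffunE.
have cS1 i : i \in S -> #|S :\ i| != 1%N.
  by move=> iS; apply: contraNneq cS => cD; rewrite (cardsD1 i) iS cD.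
rewrite [X in X + _]ffunE big1 => [|i iS]; last first.
  rewrite (_ : (fun z => a z (S :\ i)) = fun=> 0) ?pd0 ?mulr0 //.
  by apply/funext => z; rewrite a1 ?cS1.
rewrite add0r ffunE big1 // => T sTS.
have [cT|cT] := eqVneq #|T| 1%N; last by rewrite a1 // mul0r mulr0.
rewrite (a1 _ (S := S :\: T)) ?mulr0 //.
by apply: contraNneq cS => cD; rewrite -(cardsID T S) (finset.setIidPr sTS) cT cD.
Qed.

End Curvature.

Section OneForms.
Variables (n : nat) (A : pzRingType).

Lemma one_form_coef (I : finType) (f : I -> 'I_n) (c : I -> A) S :
  (\sum_k escale (c k) (egen A (f k))) S = \sum_k c k * (S == [set f k]%SET)%:R.
Proof. by rewrite sum_ffunE; apply: eq_bigr => k _; rewrite !ffunE. Qed.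

Lemma one_form_coef1 (I : finType) (f : I -> 'I_n) (c : I -> A) k : injective f ->
  (\sum_k escale (c k) (egen A (f k))) [set f k]%SET = c k.
Proof.
move=> injf; rewrite one_form_coef (bigD1 k) //= eqxx mulr1 big1 ?addr0 // => l.
by rewrite (inj_eq finset.set1_inj) (inj_eq injf) eq_sym => /negbTE ->; rewrite mulr0.
Qed.

Lemma one_form_coef0 (I : finType) (f : I -> 'I_n) (c : I -> A) (S : {set 'I_n}) :
  (forall k, S != [set f k]%SET) -> (\sum_k escale (c k) (egen A (f k))) S = 0.
Proof.
by move=> Sf; rewrite one_form_coef big1 // => k _; rewrite (negbTE (Sf k)) mulr0.
Qed.

Lemma one_form_deg (I : finType) (f : I -> 'I_n) (c : I -> A) (S : {set 'I_n}) :
  #|S| != 1%N -> (\sum_k escale (c k) (egen A (f k))) S = 0.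
Proof.
move=> cS; apply: one_form_coef0 => k.
by apply: contraNneq cS => ->; rewrite cards1.
Qed.

End OneForms.

Section PartialDerivatives.
Variable R : realType.

Lemma pder_cst n (i : 'I_n) (r : R) x : pder i (fun=> r) x = 0.
Proof. exact: derive_cst. Qed.

Lemma pderC_cst n (i : 'I_n) (z : R[i]) x : pderC i (fun=> z) x = 0.
Proof. by rewrite /pderC !pder_cst. Qed.

Lemma pderM_cst n r (i : 'I_n) (M : 'M[R[i]]_r) x : pderM i (fun=> M) x = 0.
Proof. by apply/matrixP => a b; rewrite !mxE pderC_cst. Qed.

Lemma pderC_iM n (i : 'I_n) (f : 'rV[R]_n -> R) x :
  pderC i (fun z => 'i * (f z)%:C) x = 'i * (pder i f x)%:C.
Proof.
rewrite /pderC.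
rewrite (_ : (fun z => complex.Re ('i * (f z)%:C)) = fun=> 0); last first.
  by apply/funext => z; rewrite Re_iM.
rewrite (_ : (fun z => complex.Im ('i * (f z)%:C)) = f); last first.
  by apply/funext => z; rewrite Im_iM.
rewrite pder_cst.
by apply/eqP; rewrite eq_complex Re_iM Im_iM /= !eqxx.
Qed.

Variables (m n : nat).
Implicit Types (p : 'rV[R]_(m + n)).

Lemma lsubmx_delta_l (i : 'I_m) :
  lsubmx (delta_mx 0 (lshift n i) : 'rV[R]_(m + n)) = delta_mx 0 i.
Proof. by apply/rowP => j; rewrite !mxE (inj_eq (@lshift_inj _ _)). Qed.

Lemma lsubmx_delta_r (i : 'I_n) :
  lsubmx (delta_mx 0 (rshift m i) : 'rV[R]_(m + n)) = 0.
Proof. by apply/rowP => j; rewrite !mxE eq_lrshift. Qed.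

(** As for lines, a function of the first block only and its restriction have
    the same difference quotients. *)
Lemma quotient_lsubmx (f : 'rV[R]_m -> R) p v :
  (fun h : R => h^-1 *: (((fun p => f (lsubmx p)) \o shift p) (h *: v) -
     f (lsubmx p))) =
  (fun h => h^-1 *: ((f \o shift (lsubmx p)) (h *: lsubmx v) - f (lsubmx p))).
Proof.
apply/funext => h /=; congr (_ *: (f _ - _)).
by apply/rowP => j; rewrite !mxE.
Qed.

Lemma derivable_lsubmx (f : 'rV[R]_m -> R) p v :
  derivable (fun p => f (lsubmx p)) p v <-> derivable f (lsubmx p) (lsubmx v).
Proof. by rewrite /derivable quotient_lsubmx. Qed.

Lemma derive_lsubmx (f : 'rV[R]_m -> R) p v :
  'D_v (fun p => f (lsubmx p)) p = 'D_(lsubmx v) f (lsubmx p).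
Proof. by rewrite /derive quotient_lsubmx. Qed.

Lemma pder_lsubmx_l i (f : 'rV[R]_m -> R) p :
  pder (lshift n i) (fun p => f (lsubmx p)) p = pder i f (lsubmx p).
Proof. by rewrite /pder derive_lsubmx lsubmx_delta_l. Qed.

Lemma pder_lsubmx_r i (f : 'rV[R]_m -> R) p :
  pder (rshift m i) (fun p => f (lsubmx p)) p = 0.
Proof. by rewrite /pder derive_lsubmx lsubmx_delta_r derive0. Qed.

Lemma pderC_lsubmx_l i (f : 'rV[R]_m -> R[i]) p :
  pderC (lshift n i) (fun p => f (lsubmx p)) p = pderC i f (lsubmx p).
Proof.
by rewrite /pderC (pder_lsubmx_l _ (fun z => complex.Re (f z)))
  (pder_lsubmx_l _ (fun z => complex.Im (f z))).
Qed.

Lemma pderC_lsubmx_r i (f : 'rV[R]_m -> R[i]) p :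
  pderC (rshift m i) (fun p => f (lsubmx p)) p = 0.
Proof.
by rewrite /pderC (pder_lsubmx_r _ (fun z => complex.Re (f z)))
  (pder_lsubmx_r _ (fun z => complex.Im (f z))).
Qed.

Lemma pderM_lsubmx_l r i (f : 'rV[R]_m -> 'M[R[i]]_r) p :
  pderM (lshift n i) (fun p => f (lsubmx p)) p = pderM i f (lsubmx p).
Proof.
by apply/matrixP => a b; rewrite !mxE (pderC_lsubmx_l _ (fun z => f z a b)).
Qed.

Lemma pderM_lsubmx_r r i (f : 'rV[R]_m -> 'M[R[i]]_r) p :
  pderM (rshift m i) (fun p => f (lsubmx p)) p = 0.
Proof.
by apply/matrixP => a b; rewrite !mxE (pderC_lsubmx_r _ (fun z => f z a b)).
Qed.

Lemma Ck_cst l k (U : set 'rV[R]_l) (r : R) : Ck k U (fun=> r).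
Proof.
elim: k r => [|k IH] r; split=> //; try by move=> x _; apply: cst_continuous.
move=> i; split=> [x _|]; first exact: derivable_cst.
by rewrite (_ : pder i _ = fun=> 0) //; apply/funext => x; rewrite pder_cst.
Qed.

Lemma Ck_lsubmx k (U : set 'rV[R]_m) (f : 'rV[R]_m -> R) : Ck k U f ->
  Ck k [set p : 'rV[R]_(m + n) | U (lsubmx p)]%classic (fun p => f (lsubmx p)).
Proof.
elim: k f => [|k IH] f [cf dfk].
  split=> // p Up.
  by apply: (continuous_comp _ (cf _ Up)); apply/differentiable_continuous/differentiable_lsubmx.
split=> [p Up|i].
  by apply: (continuous_comp _ (cf _ Up)); apply/differentiable_continuous/differentiable_lsubmx.
split=> [p Up|].
  apply/derivable_lsubmx; case: (split_ordP i) => j ->.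
    by rewrite lsubmx_delta_l; apply: (dfk j).1.
  by rewrite lsubmx_delta_r; apply: derivable0.
case: (split_ordP i) => j ->.
  rewrite (_ : pder _ _ = fun p => pder j f (lsubmx p)); first exact/IH/(dfk j).2.
  by apply/funext => p; rewrite pder_lsubmx_l.
rewrite (_ : pder _ _ = fun=> 0); first exact: Ck_cst.
by apply/funext => p; rewrite pder_lsubmx_r.
Qed.

Lemma smooth_on_cst l (U : set 'rV[R]_l) (r : R) : smooth_on U (fun=> r).
Proof. by move=> k; apply: Ck_cst. Qed.

Lemma smooth_on_lsubmx (U : set 'rV[R]_m) (f : 'rV[R]_m -> R) : smooth_on U f ->
  smooth_on [set p : 'rV[R]_(m + n) | U (lsubmx p)]%classic (fun p => f (lsubmx p)).
Proof. by move=> sf k; apply/Ck_lsubmx/sf. Qed.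

End PartialDerivatives.

(** * The Kahler forms and the complex coframe of the mirror *)

Lemma posdefmx_unit (R : realType) n (H : 'M[R]_n) : posdefmx H -> H \in unitmx.
Proof.
case=> _ pos; rewrite -row_free_unit -kermx_eq0; apply: contraT => nz.
have v0 : nz_row (kermx H) != 0 by rewrite nz_row_eq0.
have := pos _ v0; have /sub_kermxP -> : (nz_row (kermx H) <= kermx H)%MS.
  exact: nz_row_sub.
by rewrite mul0mx mxE ltxx.
Qed.

Section Coframes.
Variables (R : realType) (m : nat).
Notation E := (extalg (m + m) R[i]).

(** The differentials of the base coordinates (dx^k) and of the fibre
    coordinates (dy^k on M, dy~_k on W). *)
Definition eL (k : 'I_m) : E := gen R[i] (lshift m k).
Definition eR (k : 'I_m) : E := gen R[i] (rshift m k).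

Lemma alt_eL : alt_family eL.
Proof. exact: alternating_comp (alternating_gen _ _). Qed.

Lemma alt_eR : alt_family eR.
Proof. exact: alternating_comp (alternating_gen _ _). Qed.

Lemma eR_eL i j : eR i * eL j = - (eL j * eR i).
Proof. exact: (alternating_gen _ _).2. Qed.

Lemma econjD (u v : E) : econj (u + v) = econj u + econj v :> E.
Proof. by apply/ffunP => S; rewrite !ffunE rmorphD. Qed.

Lemma econj0 : econj 0 = 0 :> E.
Proof. by apply/ffunP => S; rewrite !ffunE rmorph0. Qed.

Lemma econjZ (a : R[i]) (u : E) : econj (a *: u) = conjc a *: econj u :> E.
Proof. by apply/ffunP => S; rewrite !ffunE rmorphM. Qed.

Lemma econj_sum I (r : seq I) (F : I -> E) :
  econj (\sum_(i <- r) F i) = \sum_(i <- r) econj (F i) :> E.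
Proof. by elim/big_rec2: _ => [|i x y _ <-]; rewrite ?econj0 ?econjD. Qed.

Lemma econj_gen (k : 'I_(m + m)) : econj (gen R[i] k) = gen R[i] k.
Proof. by apply/ffunP => S; rewrite !ffunE rmorph_nat. Qed.

Lemma econj_dzM j : econj (dzM R j) = eL j - 'i *: eR j :> E.
Proof. by rewrite [LHS]econjD econjZ !econj_gen conjc_i scaleNr. Qed.

Variables (L : set 'rV[R]_m) (phi : 'rV[R]_m -> R).

Lemma omegaM_E (w : tfib L) : (hessian phi w.1)^T = hessian phi w.1 ->
  omegaM phi w = \sum_i \sum_j (hessian phi w.1 i j)%:C *: (eL i * eR j) :> E.
Proof.
move=> symH; pose Hc := cmx (hessian phi w.1).
have symHc : Hc^T = Hc by rewrite /Hc -cmx_tr symH.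
transitivity (\sum_i \sum_j Hc i j *: (eL i * eR j)); last first.
  by apply: eq_bigr => i _; apply: eq_bigr => j _; rewrite mxE.
rewrite -(kahler_form alt_eL alt_eR eR_eL symHc).
apply: (congr1 (escale ('i / 2))); apply: eq_bigr => i _; apply: eq_bigr => j _.
by rewrite econj_dzM [in RHS]mxE.
Qed.

(** The differential of the coordinate x~_j of the base: the real part of the
    complex coframe of W, of which [zbar] is the conjugate. *)
Definition dx (x : 'rV[R]_m) (j : 'I_m) : E :=
  \sum_k (pder k (pder j phi) x)%:C *: eL k.

Definition zbar (x : 'rV[R]_m) (j : 'I_m) : E := dx x j - 'i *: eR j.

Lemma econj_dzW x j : econj (dzW phi x j) = zbar x j.
Proof.
rewrite [LHS]econjD econjZ econj_gen conjc_i scaleNr; congr (_ - _).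
rewrite [LHS]econj_sum; apply: eq_bigr => k _.
by rewrite [LHS]econjZ econj_gen conjc_r.
Qed.

Lemma alt_dx x : alt_family (dx x).
Proof. exact: alternating_lin alt_eL. Qed.

Lemma omegaW_E (w : tfib (dual_lattice L)) : posdefmx (hessian phi w.1) ->
  omegaW phi w = \sum_j eL j * eR j :> E.
Proof.
move=> posH; have symH := posH.1; have unitH := posdefmx_unit posH.
pose H := hessian phi w.1; pose Gc := cmx (invmx H).
have symG : (invmx H)^T = invmx H by rewrite trmx_inv symH.
have symGc : Gc^T = Gc by rewrite /Gc -cmx_tr symG.
transitivity (\sum_i \sum_j Gc i j *: (dx w.1 i * eR j)).
  rewrite -(kahler_form (alt_dx w.1) alt_eR _ symGc) => [|i j].
    apply: (congr1 (escale ('i / 2))); apply: eq_bigr => i _; apply: eq_bigr => j _.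
    by rewrite econj_dzW [in RHS]mxE.
  rewrite mulr_sumr mulr_suml -sumrN; apply: eq_bigr => k _.
  by rewrite -scalerAr -scalerAl eR_eL scalerN.
rewrite exchange_big; apply: eq_bigr => j _ /=.
transitivity ((\sum_i Gc i j *: dx w.1 i) * eR j).
  by rewrite mulr_suml; apply: eq_bigr => i _; rewrite scalerAl.
congr (_ * _).
transitivity (\sum_k ((invmx H *m H)%R j k)%:C *: eL k); last first.
  rewrite mulVmx // (bigD1 j) //= mxE eqxx scale1r big1 ?addr0 // => k nekj.
  by rewrite mxE eq_sym (negbTE nekj) scale0r.
rewrite /dx.
under eq_bigr do rewrite scaler_sumr.
rewrite exchange_big; apply: eq_bigr => k _ /=.
rewrite mxE rmorph_sum scaler_suml; apply: eq_bigr => i _.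
have -> : pder k (pder i phi) w.1 = H i k by rewrite /H -symH !mxE.
by rewrite scalerA rmorphM -[in RHS]symG !mxE.
Qed.

(** The inverse of the matrix of the complex coframe and of its conjugate: it
    expresses dx = H^-1 (dz~ + conj dz~) / 2 and dy~ = (dz~ - conj dz~) / (2i). *)
Definition coframe_inv (H : 'M[R]_m) : 'M[R[i]]_(m + m) :=
  block_mx (2^-1 *: cmx (invmx H)) (2^-1 *: cmx (invmx H))
           (- ('i / 2))%:M ('i / 2)%:M.

Lemma invmx_coframe x : posdefmx (hessian phi x) ->
  invmx (coframe_mx (dzW phi x)) = coframe_inv (hessian phi x).
Proof.
move=> posH; have symH := posH.1; have unitH := posdefmx_unit posH.
pose Hc := cmx (hessian phi x).
have dzE j k : dzW phi x j [set k]%SET =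
    row_mx Hc 'i%:M j k.
  rewrite [LHS]ffunE [X in _ + X]ffunE [X in _ + _ * X]ffunE.
  rewrite (inj_eq finset.set1_inj); case: (split_ordP k) => l ->.
    rewrite one_form_coef1; last exact: lshift_inj.
    by rewrite row_mxEl eq_lrshift mulr0 addr0 mxE -symH !mxE.
  rewrite one_form_coef0 => [|i]; last first.
    by rewrite (inj_eq finset.set1_inj) eq_rlshift.
  by rewrite row_mxEr mxE add0r (inj_eq (@rshift_inj _ _)) mulr_natr eq_sym.
have zbE j k : econj (dzW phi x j) [set k]%SET = row_mx Hc (- 'i)%:M j k.
  rewrite ffunE dzE; case: (split_ordP k) => l ->.
    by rewrite !row_mxEl mxE conjc_r.
  rewrite !row_mxEr !mxE; case: eqP => _; first by rewrite !mulr1n conjc_i.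
  by rewrite !mulr0n conjc0.
have -> : coframe_mx (dzW phi x) = block_mx Hc 'i%:M Hc (- 'i)%:M.
  rewrite /coframe_mx /block_mx; congr col_mx; apply/matrixP => j k.
    by rewrite mxE dzE.
  by rewrite mxE zbE.
have I : block_mx Hc 'i%:M Hc (- 'i)%:M *m coframe_inv (hessian phi x) = 1%:M.
  rewrite mulmx_block -!scalemxAr -map_mxM mulmxV //.
  rewrite !mul_scalar_mx ?scale_scalar_mx.
  rewrite map_scalar_mx rmorph1 !scale_scalar_mx -!raddfD /= mulr1.
  rewrite !mulNr !mulrN opprK mulrA -expr2 sqrCi mulN1r opprK.
  by rewrite subrr -mulr2n -[_ *+ 2]mulr_natr mulVf ?pnatr_eq0 // raddf0 -scalar_mx_block.
by rewrite -[RHS](mulKmx (mulmx1_unit I).1) I mulmx1.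
Qed.

End Coframes.

(** * The section and the curvature of its transform *)

Section Transform.
Variables (R : realType) (m : nat) (L : set 'rV[R]_m).
Variables (phi : 'rV[R]_m -> R) (y : 'rV[R]_m -> 'rV[R]_m).
Notation E := (extalg (m + m) R[i]).

(** The Jacobian matrix of y. *)
Definition jac (x : 'rV[R]_m) : 'M[R]_m :=
  \matrix_(j, k) pder k (fun z => y z 0 j) x.

(** The pull-backs of dx^k and dy^k to the base by the section. *)
Definition section_coframe (x : 'rV[R]_m) (k : 'I_(m + m)) : extalg m R[i] :=
  ediff (fun x' => (row_mx x' (y x')) 0 k) x.

Lemma section_coframe_L x k : section_coframe x (lshift m k) = gen R[i] k.
Proof.
rewrite /section_coframe.
have -> : (fun x' => (row_mx x' (y x')) 0 (lshift m k)) = fun x' => x' 0 k.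
  by apply/funext => x'; rewrite row_mxEl.
have D l : pder l (fun x' : 'rV[R]_m => x' 0 k) x = (k == l)%:R.
  have := derive_mx (@derivable_id _ _ x (delta_mx 0 l)).
  by rewrite derive_id => /(congr1 (fun M : 'rV[R]_m => M 0 k)); rewrite !mxE eqxx.
transitivity (\sum_l ((k == l)%:R : R[i]) *: gen R[i] l).
  by apply: eq_bigr => l _; rewrite D rmorph_nat.
rewrite (bigD1 k) //= eqxx scale1r big1 ?addr0 // => l.
by rewrite eq_sym => /negbTE ->; rewrite scale0r.
Qed.

Lemma section_coframe_R x j :
  section_coframe x (rshift m j) = \sum_k (jac x j k)%:C *: gen R[i] k.
Proof.
rewrite /section_coframe.
have -> : (fun x' => (row_mx x' (y x')) 0 (rshift m j)) = fun x' => y x' 0 j.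
  by apply/funext => x'; rewrite row_mxEr.
by apply: eq_bigr => k _; rewrite mxE.
Qed.

Lemma alt_section_coframe x : alt_family (section_coframe x).
Proof. exact: alternating_lin (alternating_gen _ _). Qed.

Lemma restrictE (u : tfib L -> ext (m + m) R[i]) x :
  Defs.restrict y u x = pull (section_coframe x) (u (tsection L y x)).
Proof. by []. Qed.

Lemma restrict_omega x : (hessian phi x)^T = hessian phi x ->
  Defs.restrict y (@omegaM R m L phi) x = quad (gen R[i]) (cmx (hessian phi x *m jac x)).
Proof.
move=> symH; rewrite restrictE omegaM_E //.
rewrite [LHS](linear_sum (pull (section_coframe x))) /=; apply: eq_bigr => i _.
rewrite linear_sum /=.
transitivity (\sum_j \sum_k ((hessian phi x i j)%:C * (jac x j k)%:C) *:
    (gen R[i] i * gen R[i] k)).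
  apply: eq_bigr => j _; rewrite linearZ /= pullM; last exact: alt_section_coframe.
  rewrite /eL /eR !pull_gen section_coframe_L section_coframe_R mulr_sumr scaler_sumr.
  by apply: eq_bigr => k _; rewrite -scalerAr scalerA.
rewrite exchange_big; apply: eq_bigr => k _ /=.
rewrite -scaler_suml; congr (_ *: _).
by rewrite [RHS]mxE mxE rmorph_sum; apply: eq_bigr => j _; rewrite rmorphM.
Qed.

Lemma restrict_Omega x :
  Defs.restrict y (@OmegaM R m L) x =
  \det (1%:M + 'i *: cmx (jac x)) *: emono R[i] [set: 'I_m]%SET.
Proof.
rewrite restrictE.
have -> : pull (section_coframe x) (OmegaM (tsection L y x)) =
    \prod_j pull (section_coframe x) (dzM R j).
  exact: (pull_prod (alt_section_coframe x) _ (fun j => dzM R j : E)).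
rewrite -[emono _ _]prod_gen.
under [X in _ *: X]eq_bigl do rewrite finset.in_setT.
rewrite -alternating_det; last exact: alternating_gen.
apply: eq_bigr => j _.
rewrite [LHS](linearD (pull (section_coframe x))) linearZ /= !pull_gen.
rewrite section_coframe_L section_coframe_R scaler_sumr.
under [RHS]eq_bigr do rewrite mxE scalerDl.
rewrite big_split /=; congr (_ + _).
  rewrite (bigD1 j) //= mxE eqxx scale1r big1 ?addr0 // => k nekj.
  by rewrite mxE eq_sym (negbTE nekj) scale0r.
by apply: eq_bigr => k _; rewrite scalerA !mxE.
Qed.

Lemma quad_block (A : algType R[i]) (g : 'I_(m + m) -> A) (N : 'M[R[i]]_m) :
  quad g (block_mx 0 N 0 0) =
  \sum_j \sum_k N k j *: (g (lshift m k) * g (rshift m j)).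
Proof.
rewrite /quad big_split_ord /= [X in _ + X]big1 ?addr0 => [|i _]; last first.
  rewrite big_split_ord /= !big1 ?addr0 // => j _.
    by rewrite block_mxEdr mxE scale0r.
  by rewrite block_mxEdl mxE scale0r.
rewrite [RHS]exchange_big /=; apply: eq_bigr => k _.
rewrite big_split_ord /= big1 ?add0r => [|j _]; last by rewrite block_mxEul mxE scale0r.
by apply: eq_bigr => j _; rewrite block_mxEur.
Qed.

Lemma fm_form_R (w : tfib (dual_lattice L)) j :
  fm_form y w [set rshift m j]%SET = 'i * (y w.1 0 j)%:C.
Proof. by rewrite ffunE one_form_coef1 //; apply: rshift_inj. Qed.

Lemma fm_form_L (w : tfib (dual_lattice L)) k :
  fm_form y w [set lshift m k]%SET = 0.
Proof.
rewrite ffunE one_form_coef0 ?mulr0 // => j.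
by rewrite (inj_eq finset.set1_inj) eq_lrshift.
Qed.

Lemma fm_form_deg (w : tfib (dual_lattice L)) (S : {set _}) : #|S| != 1%N ->
  fm_form y w S = 0.
Proof. by move=> cS; rewrite ffunE one_form_deg ?mulr0. Qed.

Lemma lsubmx_tlift (w : tfib (dual_lattice L)) : lsubmx (tlift w) = w.1.
Proof. by rewrite row_mxKl. Qed.

(** The derivatives of the components of the connection form: the only nonzero
    block is that of the derivatives along the base of the components along the
    fibre. *)
Definition curvature_mx x : 'M[R[i]]_(m + m) := block_mx 0 ('i *: cmx (jac x)^T) 0 0.

Lemma pderC_fm_form (w : tfib (dual_lattice L)) i j :
  pderC i (fun p => fm_form y (tproj (dual_lattice L) p) [set j]%SET) (tlift w) =
  curvature_mx w.1 i j.
Proof.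
case: (split_ordP j) => l ->.
  rewrite (_ : (fun p => _) = fun=> 0); last by apply/funext => p; rewrite fm_form_L.
  rewrite pderC_cst; case: (split_ordP i) => k ->.
    by rewrite block_mxEul mxE.
  by rewrite block_mxEdl mxE.
rewrite (_ : (fun p => _) = fun p => 'i * (y (lsubmx p) 0 l)%:C); last first.
  by apply/funext => p; rewrite fm_form_R.
case: (split_ordP i) => k ->.
  rewrite (pderC_lsubmx_l k (fun z => 'i * (y z 0 l)%:C)) pderC_iM block_mxEur !mxE.
  by rewrite lsubmx_tlift.
by rewrite (pderC_lsubmx_r k (fun z => 'i * (y z 0 l)%:C)) block_mxEdr mxE.
Qed.

Lemma fm_curvatureE (w : tfib (dual_lattice L)) :
  fm_curvature y w = quad (gen R[i]) (curvature_mx w.1).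
Proof.
have a1 z (S : {set _}) : #|S| != 1%N -> fm_form y (tproj (dual_lattice L) z) S = 0.
  exact: fm_form_deg.
have p0 i : pderC i (fun=> 0) (tlift w) = 0 by apply: pderC_cst.
apply: ext2P => [S|S|i j ltij].
- exact: curvature_coef0.
- exact: quad_coef0.
rewrite quad_coef // /fm_curvature /tcurvature curvature_coef // !pderC_fm_form.
by rewrite [X in _ + (_ - X)]mulrC subrr addr0.
Qed.

Lemma fm_curvature_deg (w : tfib (dual_lattice L)) (S : {set _}) : #|S| != 2 ->
  fm_curvature y w S = 0.
Proof. by move=> cS; rewrite fm_curvatureE quad_coef0. Qed.

Lemma omega_curvature_power (w : tfib (dual_lattice L)) :
  posdefmx (hessian phi w.1) ->
  epow (omegaW phi w + fm_curvature y w) m =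
  ((-1) ^+ 'C(m, 2) * m`!%:R * \det (1%:M + 'i *: cmx (jac w.1))) *:
    emono R[i] [set: 'I_(m + m)]%SET.
Proof.
move=> posH.
have epowE (u : E) k : epow u k = u ^+ k.
  by elim: k => // k IH; rewrite exprS -IH.
have -> : omegaW phi w + fm_curvature y w =
    \sum_j \sum_k (1%:M + 'i *: cmx (jac w.1)) j k *: (eL R k * eR R j) :> E.
  rewrite fm_curvatureE quad_block omegaW_E // -[RHS]/(_ : E).
  rewrite -big_split; apply: eq_bigr => j _.
  under [RHS]eq_bigr do rewrite mxE scalerDl.
  rewrite big_split; congr (_ + _).
    rewrite (bigD1 j) //= mxE eqxx scale1r big1 ?addr0 // => k nekj.
    by rewrite mxE eq_sym (negbTE nekj) scale0r.
  by apply: eq_bigr => k _; rewrite !mxE.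
rewrite epowE symplectic_power; last exact: alternating_gen.
rewrite -[emono _ _]prod_gen; congr (_ *: _).
by apply: eq_bigl => i; rewrite finset.in_setT.
Qed.

End Transform.

(** * The (0,2)-part of the curvature *)

(** The (0,1)-parts of the coframe, as elements of the exterior algebra. *)
Definition proj01 (R : realType) (m : nat) (dz : 'I_m -> ext (m + m) R[i]) :
  'I_(m + m) -> extalg (m + m) R[i] := part01 dz.

(** On forms of degree two, the (0,2)-part is the substitution of its (0,1)-part
    for each e_k. *)
Lemma pq_part02 (R : realType) (m : nat) (dz : 'I_m -> ext (m + m) R[i])
    (u : ext (m + m) R[i]) : (forall S : {set _}, #|S| != 2 -> u S = 0) ->
  pq_part dz 0 2 u = pull (proj01 dz) u.
Proof.
move=> u2; rewrite /pq_part; apply: eq_bigr => S _.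
have [cS|cS] := eqVneq #|S| 2; last first.
  rewrite u2 // scale0r; apply: big1 => T _; exact: (scale0r (_ : extalg _ _)).
rewrite (big_pred1 (finset.set0 : {set 'I_(m + m)})) => [|T] /=.
  by congr (escale _ _); apply: eq_bigr => k _; rewrite finset.in_set0.
rewrite cards_eq0; case: eqVneq => [->|_]; last by rewrite andbF.
by rewrite finset.sub0set finset.setD0 cS.
Qed.

Lemma pull_quad_comp (K : comNzRingType) n (A : algType K)
    (eta : 'I_n -> A) (I : nat) (e : 'I_I -> extalg n K) M : alt_family eta ->
  pull eta (quad e M) = quad (fun i => pull eta (e i)) M.
Proof.
move=> alt_eta; rewrite linear_sum; apply: eq_bigr => i _.
rewrite linear_sum; apply: eq_bigr => j _.
by rewrite linearZ /= pullM.
Qed.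

Section ZeroTwo.
Variables (R : realType) (m : nat) (L : set 'rV[R]_m).
Variables (phi : 'rV[R]_m -> R) (y : 'rV[R]_m -> 'rV[R]_m).
Notation E := (extalg (m + m) R[i]).
Notation zbar := (zbar phi).

Lemma proj01_L x k : posdefmx (hessian phi x) ->
  proj01 (dzW phi x) (lshift m k) =
  \sum_j (2^-1 * (invmx (hessian phi x) k j)%:C) *: zbar x j.
Proof.
move=> posH; apply: eq_bigr => j _.
by rewrite invmx_coframe // block_mxEur !mxE econj_dzW.
Qed.

Lemma proj01_R x k : posdefmx (hessian phi x) ->
  proj01 (dzW phi x) (rshift m k) = ('i / 2) *: zbar x k.
Proof.
move=> posH; rewrite [LHS](bigD1 k) //= invmx_coframe // block_mxEdr !mxE eqxx.
rewrite econj_dzW big1 => [|j nekj]; first by rewrite addr0.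
rewrite block_mxEdr mxE eq_sym (negbTE nekj) mulr0n.
exact: (scale0r (econj (dzW phi x j) : E)).
Qed.

Lemma alt_zbar x : alt_family (zbar x).
Proof.
pose c j (k : 'I_(m + m)) : R[i] := match fintype.split k with
  | inl k => (pder k (pder j phi) x)%:C | inr l => if l == j then - 'i else 0 end.
suff -> : zbar x = fun j => \sum_k c j k *: gen R[i] k.
  exact: alternating_lin (alternating_gen _ _).
have split_l k : fintype.split (lshift m k) = inl k by exact: (unsplitK (inl k)).
have split_r k : fintype.split (rshift m k) = inr k by exact: (unsplitK (inr k)).
apply/funext => j; rewrite big_split_ord /=; congr (_ + _).
  by apply: eq_bigr => k _; rewrite /c split_l.
rewrite (bigD1 j) //= /c split_r eqxx big1 ?addr0 ?scaleNr // => k nekj.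
by rewrite split_r (negbTE nekj) scale0r.
Qed.

Lemma alt_proj01 x : alt_family (proj01 (dzW phi x)).
Proof.
rewrite /proj01 /part01; under eq_fun do under eq_bigr do rewrite econj_dzW.
exact: alternating_lin (alt_zbar x).
Qed.

(** The substitution dx^k -> 0, dy~_k -> i e_k, which takes [zbar] to the
    standard generators; it witnesses that the zbar_l zbar_j are independent. *)
Definition fibre_coframe (k : 'I_(m + m)) : extalg m R[i] :=
  match fintype.split k with inl _ => 0 | inr j => 'i *: gen R[i] j end.

Lemma alt_fibre_coframe : alt_family fibre_coframe.
Proof.
rewrite /fibre_coframe; have [g0 gN] := alternating_gen m R[i].
split=> [i|i j].
  case: (fintype.split i) => k; first by rewrite mul0r.
  by rewrite -scalerAl -scalerAr g0 !scaler0.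
case: (fintype.split i) => k; case: (fintype.split j) => l; rewrite ?mul0r ?mulr0 ?oppr0 //.
by rewrite -!scalerAl -!scalerAr gN !scalerN.
Qed.

Lemma pull_zbar x j : pull fibre_coframe (zbar x j) = gen R[i] j.
Proof.
have gR k : pull fibre_coframe (eR R k) = 'i *: gen R[i] k.
  by rewrite pull_gen /fibre_coframe -[rshift _ _]/(unsplit (inr k)) unsplitK.
have gL k : pull fibre_coframe (eL R k) = 0.
  by rewrite pull_gen /fibre_coframe -[lshift _ _]/(unsplit (inl k)) unsplitK.
rewrite linearB linearZ /= gR scalerA -expr2 sqrCi scaleN1r opprK.
rewrite linear_sum big1 ?add0r // => k _.
by rewrite linearZ /= gL scaler0.
Qed.

Lemma fm_curvature02 (w : tfib (dual_lattice L)) : posdefmx (hessian phi w.1) ->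
  pq_part (dzW phi w.1) 0 2 (fm_curvature y w) =
  (- 4^-1) *: quad (zbar w.1) (cmx (jac y w.1 *m invmx (hessian phi w.1))^T).
Proof.
move=> posH; rewrite pq_part02; last exact: fm_curvature_deg.
rewrite fm_curvatureE [LHS]pull_quad; last exact: alt_proj01.
rewrite quad_block; set Hi := invmx _; set Y := jac y w.1.
transitivity (\sum_j \sum_l (- 4^-1 * ((Y *m Hi) j l)%:C) *: (zbar w.1 l * zbar w.1 j)).
  apply: eq_bigr => j _.
  transitivity (\sum_k \sum_l (- 4^-1 * ((Y j k)%:C * (Hi k l)%:C)) *: (zbar w.1 l * zbar w.1 j)).
    apply: eq_bigr => k _; rewrite proj01_L // proj01_R // mulr_suml scaler_sumr.
    have -> : ('i *: cmx Y^T) k j = 'i * (Y j k)%:C by rewrite !mxE.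
    apply: eq_bigr => l _; rewrite -scalerAl -scalerAr !scalerA.
    congr (_ *: _).
    have i2 : 'i * 'i = -1 :> R[i] by rewrite -expr2 sqrCi.
    rewrite [LHS](_ : _ = ('i * 'i) * (2^-1 * 2^-1) * ((Y j k)%:C * (Hi k l)%:C)); last by ring.
    by rewrite i2 mulN1r -invfM -natrM.
  rewrite exchange_big; apply: eq_bigr => l _ /=.
  rewrite -scaler_suml -mulr_sumr; congr ((_ * _) *: _).
  by rewrite mxE rmorph_sum; apply: eq_bigr => k _; rewrite rmorphM.
rewrite exchange_big scaler_sumr; apply: eq_bigr => l _ /=.
rewrite scaler_sumr; apply: eq_bigr => j _.
by rewrite scalerA !mxE.
Qed.

(** Y H^-1 is symmetric iff H Y is, H being symmetric. *)
Lemma fm_curvature02_eq0 (w : tfib (dual_lattice L)) : posdefmx (hessian phi w.1) ->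
  pq_part (dzW phi w.1) 0 2 (fm_curvature y w) = 0 <->
  Defs.restrict y (@omegaM R m L phi) w.1 = 0.
Proof.
move=> posH; have symH := posH.1; have unitH := posdefmx_unit posH.
rewrite restrict_omega // fm_curvature02 //.
set H := hessian phi w.1 in symH unitH *; set Y := jac y w.1.
have symP (M : 'M[R]_m) : (cmx M)^T = cmx M <-> M^T = M.
  by rewrite -cmx_tr; split=> [/cmx_inj|->].
have HY : (H *m Y)^T = H *m Y <-> ((Y *m invmx H)^T)^T = (Y *m invmx H)^T.
  rewrite trmxK !trmx_mul trmx_inv symH; split=> E.
    rewrite -[LHS](mulKmx unitH); congr (_ *m _).
    by rewrite mulmxA -E -mulmxA mulmxV // mulmx1.
  by rewrite -[in RHS](mulmxKV unitH Y) E !mulmxA mulmxV // mul1mx.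
have n4 : (- 4^-1 : R[i]) != 0 by rewrite oppr_eq0 invr_eq0 pnatr_eq0.
split=> [E|E].
  apply/quad_eq0/symP/HY/symP/quad_eq0.
  have : quad (zbar w.1) (cmx (Y *m invmx H)^T) = 0.
    have := congr1 (fun u : extalg (m + m) R[i] => (- 4^-1)^-1 *: u) E.
    by rewrite scalerA mulVf // scale1r scaler0.
  move=> /(congr1 (pull fibre_coframe)).
  rewrite pull_quad_comp; last exact: alt_fibre_coframe.
  rewrite linear0 => <-; congr (quad _ _); apply/funext => j.
  by rewrite pull_zbar.
rewrite quad_sym ?scaler0 //; first exact: alt_zbar.
by apply/symP/HY/symP/quad_eq0.
Qed.

Lemma phase_iff n (c t : R) (z : R[i]) (S0 : {set 'I_n}) : c != 0 ->
  (emap (@complex.Im R) ((c%:C * z) *: emono R[i] S0) =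
     escale t (emap (@complex.Re R) ((c%:C * z) *: emono R[i] S0))) <->
  complex.Im z = t * complex.Re z.
Proof.
move=> c0; split=> [/ffunP/(_ S0)|E].
  rewrite !ffunE eqxx !mulr1 Re_rM Im_rM mulrCA => /mulfI; exact.
apply/ffunP => S; rewrite !ffunE; case: eqP => _; last by rewrite !mulr0.
by rewrite !mulr1 Re_rM Im_rM E mulrCA.
Qed.

End ZeroTwo.

(** * Connections of higher rank *)

Section Emap.
Variables (n : nat) (A A' : pzRingType) (f : {rmorphism A -> A'}).

Lemma emapD (u v : ext n A) : emap f (u + v) = emap f u + emap f v.
Proof. by apply/ffunP => S; rewrite !ffunE rmorphD. Qed.

Lemma emap_wedge (u v : ext n A) : emap f (wedge u v) = wedge (emap f u) (emap f v).
Proof.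
apply/ffunP => S; rewrite !ffunE rmorph_sum; apply: eq_bigr => T _.
by rewrite rmorphM rmorph_sign rmorphM !ffunE.
Qed.

Lemma emap_epow (u : ext n A) k : emap f (epow u k) = epow (emap f u) k.
Proof.
elim: k => [|k IH]; last by rewrite [LHS]emap_wedge IH.
by apply/ffunP => S; rewrite !ffunE rmorph_nat.
Qed.

End Emap.

Section Hermitian.
Variables (R : realType) (r : nat).

Lemma adjmx_scalar (z : R[i]) : adjmx (z%:M : 'M[R[i]]_r) = (conjc z)%:M.
Proof. by rewrite /adjmx tr_scalar_mx map_scalar_mx. Qed.

Lemma hermRe_scalar (z : R[i]) : hermRe (z%:M : 'M[R[i]]_r) = (complex.Re z)%:C%:M.
Proof.
by rewrite /hermRe adjmx_scalar -raddfD /= addcJ scale_scalar_mx mulKf ?pnatr_eq0.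
Qed.

Lemma hermIm_scalar (z : R[i]) : hermIm (z%:M : 'M[R[i]]_r) = (complex.Im z)%:C%:M.
Proof.
rewrite /hermIm adjmx_scalar -raddfB /= subcJ scale_scalar_mx complexiE.
by rewrite [2 * _ * 'i]mulrAC mulKf // mulf_neq0 ?pnatr_eq0 ?neq0Ci.
Qed.

End Hermitian.

Section HigherRank.
Variables (R : realType) (m r : nat) (L : set 'rV[R]_m).
Variables (phi : 'rV[R]_m -> R) (y : 'rV[R]_m -> 'rV[R]_m).
Variable a : 'I_m -> 'rV[R]_m -> 'M[R[i]]_r.
Notation W := (tfib (dual_lattice L)).

Lemma fm_formA_R (w : W) j :
  fm_formA y a w [set rshift m j]%SET = ('i * (y w.1 0 j)%:C)%:M.
Proof.
rewrite ffunE [X in X + _]ffunE fm_form_R one_form_coef0 ?addr0 // => k.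
by rewrite (inj_eq finset.set1_inj) eq_rlshift.
Qed.

Lemma fm_formA_L (w : W) k : fm_formA y a w [set lshift m k]%SET = a k w.1.
Proof.
rewrite ffunE [X in X + _]ffunE fm_form_L raddf0 add0r.
by rewrite one_form_coef1 //; apply: lshift_inj.
Qed.

Lemma fm_formA_deg (w : W) (S : {set _}) : #|S| != 1%N -> fm_formA y a w S = 0.
Proof.
by move=> cS; rewrite ffunE [X in X + _]ffunE fm_form_deg // raddf0 add0r one_form_deg.
Qed.

Lemma base_form_coef x k : base_form a x [set k]%SET = a k x.
Proof. by rewrite [LHS]one_form_coef1. Qed.

Lemma base_form_deg x (S : {set _}) : #|S| != 1%N -> base_form a x S = 0.
Proof. exact: one_form_deg. Qed.

Lemma pderM_scalar n (i : 'I_n) (f : 'rV[R]_n -> R[i]) x :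
  pderM i (fun z => (f z)%:M : 'M[R[i]]_r) x = (pderC i f x)%:M.
Proof.
apply/matrixP => b c; rewrite !mxE; case: eqVneq => [->|nebc].
  by rewrite mulr1n; congr (pderC i _ x); apply/funext => z; rewrite mxE eqxx.
rewrite mulr0n (_ : (fun z => _) = fun=> 0) ?pderC_cst //.
by apply/funext => z; rewrite mxE (negbTE nebc).
Qed.

Lemma base_curvature_coef (i j : 'I_m) x : (i < j)%N ->
  curvature (@pderM R m r) (base_form a) x [set i; j]%SET =
  pderM i (a j) x - pderM j (a i) x + (a i x * a j x - a j x * a i x).
Proof.
move=> ltij; rewrite curvature_coef //; last exact: base_form_deg.
rewrite !base_form_coef.
by congr (pderM i _ x - pderM j _ x + _); apply/funext => z; rewrite base_form_coef.
Qed.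

(** Where a is flat, the curvature of the rank r connection is F Id. *)
Lemma fm_curvatureA (w : W) :
    curvature (@pderM R m r) (base_form a) w.1 = 0 ->
  tcurvature (@pderM R (m + m) r) (@fm_formA R m r L y a) w =
  emap (@scalar_mx _ r) (fm_curvature y w).
Proof.
move=> flat.
have p0 i : pderM i (fun=> 0 : 'M[R[i]]_r) (tlift w) = 0 by apply: pderM_cst.
apply: ext2P => [S|S cS|i j ltij].
- by apply: curvature_coef0 => // z T; apply: fm_formA_deg.
- by rewrite [LHS]ffunE fm_curvature_deg // raddf0.
rewrite [RHS]ffunE fm_curvatureE quad_coef //.
rewrite /tcurvature curvature_coef //; last by move=> z S; apply: fm_formA_deg.
have AR k : (fun p => fm_formA y a (tproj (dual_lattice L) p) [set rshift m k]%SET) =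
    fun p => ('i * (y (lsubmx p) 0 k)%:C)%:M.
  by apply/funext => p; rewrite fm_formA_R.
have AL k : (fun p => fm_formA y a (tproj (dual_lattice L) p) [set lshift m k]%SET) =
    fun p => a k (lsubmx p).
  by apply/funext => p; rewrite fm_formA_L.
have pR k l : pderC (rshift m l) (fun p => 'i * (y (lsubmx p) 0 k)%:C) (tlift w) = 0.
  exact: (pderC_lsubmx_r l (fun z => 'i * (y z 0 k)%:C)).
have pL k l : pderC (lshift m l) (fun p => 'i * (y (lsubmx p) 0 k)%:C) (tlift w) =
    'i * (jac y w.1 k l)%:C.
  rewrite (pderC_lsubmx_l l (fun z => 'i * (y z 0 k)%:C)) pderC_iM mxE.
  by rewrite lsubmx_tlift.
have scC (z : R[i]) (M : 'M[R[i]]_r) : z%:M * M - M * z%:M = 0.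
  by apply/eqP; rewrite subr_eq0; apply/eqP; exact: comm_scalar_mx.
case: (split_ordP i) ltij => k ->; case: (split_ordP j) => l -> ltij.
- rewrite !AL !fm_formA_L /= lsubmx_tlift !pderM_lsubmx_l lsubmx_tlift.
  rewrite -base_curvature_coef // flat ffunE /curvature_mx !block_mxEul !mxE.
  by rewrite subrr raddf0.
- rewrite AL AR !fm_formA_L !fm_formA_R pderM_scalar pderM_lsubmx_r pL.
  rewrite -[X in _ + X]opprB scC !oppr0 !addr0 /curvature_mx.
  by rewrite block_mxEur block_mxEdl !mxE subr0.
- by move: ltij; rewrite /= ltnNge ltnW // ltn_addr.
- rewrite !AR !fm_formA_R !pderM_scalar !pR scC /curvature_mx !block_mxEdr !mxE.
  by rewrite !subrr addr0 !raddf0.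
Qed.

Lemma pq_part_scalar (dz : 'I_m -> ext (m + m) R[i]) p q (u : ext (m + m) R[i]) :
  pq_part dz p q u = 0 -> pq_partM dz p q (emap (@scalar_mx _ r) u) = 0.
Proof.
move=> u0; apply/ffunP => S; rewrite !ffunE; apply/matrixP => b c; rewrite !mxE.
have -> : emap (fun X : 'M[R[i]]_r => X b c) (emap (@scalar_mx _ r) u) =
    if b == c then u else 0.
  apply/ffunP => T; rewrite !ffunE !mxE.
  by case: eqVneq; rewrite ?mulr1n ?mulr0n ?ffunE.
case: eqVneq => _; first by rewrite u0 ffunE.
rewrite /pq_part big1 ?ffunE // => T _; apply: big1 => U _.
by rewrite ffunE; apply: (scale0r (_ : extalg (m + m) R[i])).
Qed.

Lemma dHYM_scalar (u : ext (m + m) R[i]) t :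
    emap (@complex.Im R) u = escale t (emap (@complex.Re R) u) ->
  emap (@hermIm R r) (emap (@scalar_mx _ r) u) =
  escale t%:C%:M (emap (@hermRe R r) (emap (@scalar_mx _ r) u)).
Proof.
move=> /ffunP uS; apply/ffunP => S; have := uS S; rewrite !ffunE => E.
by rewrite hermIm_scalar hermRe_scalar E rmorphM scalar_mxM.
Qed.

Lemma fm_formA_unitary (B : set 'rV[R]_m) :
    (forall j, smooth_on B (fun x => y x 0 j)) ->
    unitary_connection B (base_form a) ->
  unitary_connection [set p | B (lsubmx p)]%classic
    (fun p => fm_formA y a (tproj (dual_lattice L) p)).
Proof.
move=> sy [_ skew sa]; split=> [p S _|p S Bp|S b c].
- exact: fm_formA_deg.
- have [/eqP/cards1P[i ->]|cS] := eqVneq #|S| 1%N; last first.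
    by rewrite fm_formA_deg // /adjmx trmx0 map_mx0 oppr0.
  case: (split_ordP i) => k ->.
    by rewrite fm_formA_L -base_form_coef skew.
  rewrite fm_formA_R adjmx_scalar -raddfN; congr scalar_mx.
  exact: conjc_iM.
have [/eqP/cards1P[i ->]|cS] := eqVneq #|S| 1%N; last first.
  split; rewrite (_ : (fun p => _) = fun=> 0); try exact: smooth_on_cst;
  by apply/funext => p; rewrite fm_formA_deg // mxE.
case: (split_ordP i) => k ->.
  have [sRe sIm] := sa [set k]%SET b c.
  have AkE p : fm_formA y a (tproj (dual_lattice L) p) [set lshift m k]%SET b c =
      base_form a (lsubmx p) [set k]%SET b c.
    by rewrite fm_formA_L base_form_coef.
  split.
    rewrite (_ : (fun p => complex.Re _) =
      fun p => complex.Re (base_form a (lsubmx p) [set k]%SET b c)).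
      exact: (smooth_on_lsubmx _ sRe).
    by apply/funext => p; rewrite AkE.
  rewrite (_ : (fun p => complex.Im _) =
    fun p => complex.Im (base_form a (lsubmx p) [set k]%SET b c)).
    exact: (smooth_on_lsubmx _ sIm).
  by apply/funext => p; rewrite AkE.
have [ebc|nebc] := eqVneq b c; last first.
  split; rewrite (_ : (fun p => _) = fun=> 0); try exact: smooth_on_cst;
  by apply/funext => p; rewrite fm_formA_R mxE (negbTE nebc).
split.
  rewrite (_ : (fun p => _) = fun=> 0); first exact: smooth_on_cst.
  by apply/funext => p; rewrite fm_formA_R mxE ebc eqxx mulr1n Re_iM.
rewrite (_ : (fun p => _) = fun p => (fun x => y x 0 k) (lsubmx p)).
  exact: (smooth_on_lsubmx _ (sy k)).
by apply/funext => p; rewrite fm_formA_R mxE ebc eqxx mulr1n Im_iM.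
Qed.

End HigherRank.

(** In rank one, a flat unitary connection form on a ball is i de for a real
    function e. *)
Lemma flat_unitary_line (R : realType) (m : nat) (c : 'rV[R]_m) (rho : R)
    (a : 'I_m -> 'rV[R]_m -> 'M[R[i]]_1) :
    flat_unitary (open_ball c rho) a ->
  exists2 e : 'rV[R]_m -> R, smooth_on (open_ball c rho) e &
    forall x k, open_ball c rho x -> a k x = ('i * (pder k e x)%:C)%:M.
Proof.
move=> [[_ skew sa] flat].
pose b k x := complex.Im (a k x 0 0).
have ab k x : open_ball c rho x -> a k x = ('i * (b k x)%:C)%:M.
  move=> Bx; rewrite [LHS]mx11_scalar; congr _%:M.
  have := skew x [set k]%SET Bx; rewrite base_form_coef => /matrixP/(_ 0 0).
  rewrite !mxE /b; case: (a k x 0 0) => u v /eqP.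
  rewrite eq_complex /= => /andP[uu _]; apply/eqP.
  rewrite eq_complex Re_iM Im_iM /= eqxx andbT.
  by move: uu; rewrite -addr_eq0 -mulr2n mulrn_eq0.
have [||e se de] := @poincare_ball R m c rho b.
- move=> j; have [_] := sa [set j]%SET 0 0.
  by rewrite /b; under eq_fun do rewrite base_form_coef.
- have closed (i j : 'I_m) x : (i < j)%N -> open_ball c rho x -> pder i (b j) x = pder j (b i) x.
    move=> ltij Bx; have := congr1 (fun u : ext m 'M[R[i]]_1 => u [set i; j]%SET) (flat x Bx).
    rewrite base_curvature_coef // ffunE.
    rewrite (_ : a i x * a j x - _ = 0); last first.
      rewrite [a i x]mx11_scalar; apply/eqP; rewrite subr_eq0; apply/eqP; exact: comm_scalar_mx.
    rewrite addr0 => /matrixP/(_ 0 0); rewrite !mxE => /(congr1 (@complex.Im R)) /= /eqP.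
    by rewrite subr_eq0 => /eqP.
  move=> i j x Bx; have [/closed->|/closed->|/val_inj->] := ltngtP i j; by [].
by exists e => // x k Bx; rewrite ab // de.
Qed.

(** * The two phase conditions *)

(** Both conditions say that Im d = tan theta * Re d for d = det (1 + i Y). *)
Lemma phase_condition_dHYM (R : realType) (m : nat) (L : set 'rV[R]_m)
    (B : set 'rV[R]_m) (phi : 'rV[R]_m -> R) (y : 'rV[R]_m -> 'rV[R]_m) (theta : R) :
    (forall x, B x -> posdefmx (hessian phi x)) ->
  phase_condition L B y theta <-> dHYM B phi (@fm_curvature R m L y) theta.
Proof.
move=> posH.
pose d x : R[i] := \det (1%:M + 'i *: cmx (jac y x)).
(* the constant by which the two top forms differ *)
pose K : R := (-1) ^+ 'C(m, 2) * m`!%:R.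
have K0 : K != 0 by rewrite mulf_neq0 ?signr_eq0 // pnatr_eq0 -lt0n fact_gt0.
have phaseE x : B x ->
    (emap (@complex.Im R) (Defs.restrict y (@OmegaM R m L) x) =
     escale (tan theta) (emap (@complex.Re R) (Defs.restrict y (@OmegaM R m L) x))) <->
    complex.Im (d x) = tan theta * complex.Re (d x).
  move=> Bx; rewrite restrict_Omega -/(d x).
  have := phase_iff (tan theta) (d x) [set: 'I_m]%SET (oner_neq0 R).
  by rewrite rmorph1 mul1r.
have dHYME (w : tfib (dual_lattice L)) : B w.1 ->
    (emap (@complex.Im R) (epow (omegaW phi w + fm_curvature y w) m) =
     escale (tan theta) (emap (@complex.Re R) (epow (omegaW phi w + fm_curvature y w) m))) <->
    complex.Im (d w.1) = tan theta * complex.Re (d w.1).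
  move=> Bw; rewrite omega_curvature_power; last exact: posH.
  rewrite -/(d w.1) (_ : (-1) ^+ _ * _ = K%:C); first exact: phase_iff.
  by rewrite rmorphM rmorph_sign rmorph_nat.
split=> [H w Bw|H x Bx]; first by apply/(dHYME _ Bw)/(phaseE _ Bw)/H.
by apply/(phaseE _ Bx)/(dHYME (x, tclass _ 0) Bx)/H.
Qed.

Theorem mainTheorem1 (R : realType) (m : nat)
  (c : 'rV[R]_m) (rho : R) (rho_gt0 : 0 < rho)
  (L : set 'rV[R]_m) (L_lattice : is_lattice L)
  (phi : 'rV[R]_m -> R)
  (phi_smooth : smooth_on (open_ball c rho) phi)
  (phi_posdef : forall x, open_ball c rho x -> posdefmx (hessian phi x))
  (phi_MA : exists k : R,
     forall x, open_ball c rho x -> \det (hessian phi x) = k)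
  (y : 'rV[R]_m -> 'rV[R]_m)
  (y_smooth : forall j, smooth_on (open_ball c rho) (fun x => y x 0 j))
  (theta : R) (theta_gt : - (pi / 2) < theta) (theta_lt : theta < pi / 2) :
  let B := open_ball c rho in
  [/\ (forall w : tfib (dual_lattice L), B w.1 ->
         pq_part (dzW phi w.1) 0 2 (fm_curvature y w) = 0)
      <-> lagrangian L B phi y,
      lagrangian L B phi y ->
      (special_lagrangian L B phi y theta <->
       dHYM B phi (@fm_curvature R m L y) theta)
    & special_lagrangian L B phi y theta ->
      forall (r : nat) (a : 'I_m -> 'rV[R]_m -> 'M[R[i]]_r),
        (0 < r)%N -> flat_unitary B a ->
        type_B_cycle B phi (@fm_formA R m r L y a) theta /\
        (r = 1%N ->
         exists2 e : 'rV[R]_m -> R, smooth_on B e &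
           forall x k, B x -> a k x = ('i * (pder k e x)%:C)%:M)].
Proof.
move=> B.
have lagE : (forall w : tfib (dual_lattice L), B w.1 ->
    pq_part (dzW phi w.1) 0 2 (fm_curvature y w) = 0) <-> lagrangian L B phi y.
  split=> [F02 x Bx|lag w Bw].
    pose w : tfib (dual_lattice L) := (x, tclass _ 0).
    exact: (fm_curvature02_eq0 y (w := w) (phi_posdef _ Bx)).1 (F02 w Bx).
  exact: (fm_curvature02_eq0 y (w := w) (phi_posdef _ Bw)).2 (lag _ Bw).
have phaseE := @phase_condition_dHYM _ _ L B phi y theta phi_posdef.
split=> // [lag|[lag phase] r a r0 flat_a].
  by split=> [[_ /phaseE]|/phaseE].
have FA w : B w.1 -> tcurvature (@pderM R (m + m) r) (@fm_formA R m r L y a) w =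
    emap (@scalar_mx _ r) (fm_curvature y w).
  by move=> Bw; apply/fm_curvatureA/flat_a.2.
split; last by move=> r1; subst r; apply: flat_unitary_line flat_a.
split=> [|w Bw|w Bw].
- exact: fm_formA_unitary flat_a.1.
- by rewrite FA //; apply: pq_part_scalar; apply: lagE.2.
- rewrite FA // -emapD -emap_epow; apply: dHYM_scalar.
  by move/phaseE: phase; apply.
Qed.
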